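(* Let $(\mathcal{F}\subseteq\mathcal{A},E)$ be an $\mathcal{F}$-valued probability space and $(\mathcal{A},\phi)$ a scalar probability space which are compatible, i.e. $\phi(x)=\phi(E(x))$ for all $x\in\mathcal{A}$. Suppose that $a\in\mathcal{A}$ is $R$-diagonal with amalgamation over $\mathcal{F}$ (with respect to $E$), and that $aa^\star$ and $\mathcal{F}$ are free (with respect to $\phi$). Then $a$ is $R$-diagonal in the scalar sense (with respect to $\phi$).
   Context: All algebras are unital over $\mathbb{C}$, all inclusions are unital. A scalar probability space $(\mathcal{A},\phi)$ is a unital $\star$-algebra with a normal, tracial, faithful state $\phi$. A $\mathcal{D}$-valued probability space $(\mathcal{D}\subseteq\mathcal{A},E)$ is a unital $\star$-algebra $\mathcal{A}$, a unital $\star$-subalgebra $\mathcal{D}$ and a conditional expectation $E:\mathcal{A}\to\mathcal{D}$ (linear, $E(I)=I$, $E(d_1xd_2)=d_1E(x)d_2$ for $d_1,d_2\in\mathcal D$). Freeness. Subsets $(X_s)_{s\in S}$ of $\mathcal{A}$ are free with amalgamation over $\mathcal{D}$ if, with $\mathcal{A}_s$ the algebra generated by $X_s\cup\mathcal{D}$, one has $E(x_1\cdots x_n)=0$ whenever $n\ge1$, $x_j\in\mathcal{A}_{s_j}$, $E(x_j)=0$ for all $j$, and $s_1\ne s_2\ne\dots\ne s_n$ (consecutive indices distinct). ''Free'' means free with amalgamation over $\mathbb{C}$ with respect to $\phi$. Cumulants. The $\mathcal{D}$-valued noncrossing cumulants are the $\mathcal{D}$-bimodule maps $\kappa:\mathcal{A}^{\otimes_{\mathcal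 D}n}\to\mathcal{D}$ ($n\ge1$) determined by $E(a_1\cdots a_n)=\sum_{\pi\in NC(\{1,\dots,n\})}\kappa_\pi(a_1\otimes\cdots\otimes a_n)$, where the sum is over noncrossing partitions and $\kappa_\pi$ is the nested product: $\kappa_\pi=\kappa$ if $\pi$ has one block; otherwise choose a block of $\pi$ that is an interval $\{p+1,\dots,p+q\}$, remove it, and multiply $\kappa(a_{p+1}\otimes\cdots\otimes a_{p+q})$ into the right of $a_p$ (equivalently into the left of $a_{p+q+1}$), continuing recursively (e.g. $\kappa_{\{\{1,3\},\{2\}\}}(a_1\otimes a_2\otimes a_3)=\kappa(a_1\otimes\kappa(a_2)a_3)$). $R$-diagonality. $a\in\mathcal{A}$ is $R$-diagonal with amalgamation over $\mathcal{D}$ if $\kappa(d_1a^{s_1}\otimes\cdots\otimes d_na^{s_n})=0$ for all $n\ge1$, $d_i\in\mathcal{D}$, $s_i\in\{1,\star\}$ such that $(s_1,\dots,s_n)$ is not of the form $(1,\star,\dots,1,\star)$ or $(\star,1,\dots,\star,1)$. Scalar $R$-diagonality is the case $\mathcal{D}=\mathbb{C}$, $E=\phi$. *)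

(* Defs.v *)
(* MathComp / MathComp-Analysis world; the complex numbers are R[i], R : realType. *)
From HB Require Import structures.
From mathcomp Require Export all_boot all_order all_algebra.
From mathcomp Require Export complex.
From mathcomp Require Export boolp classical_sets reals.
From mathcomp Require Import zify.

Set Implicit Arguments.
Unset Strict Implicit.
Unset Printing Implicit Defensive.

Import Order.TTheory GRing.Theory Num.Theory.

#[global] Open Scope classical_set_scope.
#[global] Open Scope ring_scope.

Section ProbabilitySpaces.
Variables (R : realType) (A : algType R[i]) (star : A -> A).
Local Notation C := R[i].

Record star_algebra : Prop := StarAlgebra {
  starK : involutive star;
  star_antilinear : forall (c : C) x y,
    star (c *: x + y) = Num.conj c *: star x + star y;
  star_antimul : forall x y, star (x * y) = star y * star x }.

Definition unital_subalgebra (B : set A) : Prop := GRing.subalg_closed (mem B).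

Definition unital_star_subalgebra (B : set A) : Prop :=
  unital_subalgebra B /\ forall x, B x -> B (star x).

Definition generated_algebra (X : set A) : set A := smallest unital_subalgebra X.

(* The order induced by the cone of finite sums of elements x^* x; in a
   C*-algebra this is the usual order. *)
Definition star_le (x y : A) : Prop :=
  exists s : seq A, y - x = \sum_(z <- s) star z * z.

Definition star_lub (S : set A) (u : A) : Prop :=
  (forall x, S x -> star_le x u) /\
  (forall v, (forall x, S x -> star_le x v) -> star_le u v).

(* phi preserves least upper bounds of upward directed sets of self-adjoint
   elements.  For c : C, [phi x <= c] is the order of R[i] in which
   [0 <= z] iff z is a nonnegative real. *)
Definition normal_functional (phi : A -> C) : Prop :=
  forall (S : set A) (u : A),
    S !=set0 ->
    (forall x, S x -> star x = x) ->
    (forall x y, S x -> S y -> exists z, [/\ S z, star_le x z & star_le y z]) ->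
    star_lub S u ->
    (forall x, S x -> phi x <= phi u) /\
    (forall c : C, (forall x, S x -> phi x <= c) -> phi u <= c).

Record scalar_probability_space (phi : {scalar A}) : Prop :=
  ScalarProbabilitySpace {
    sps_star : star_algebra;
    sps_unit : phi 1 = 1;
    sps_positive : forall x, 0 <= phi (star x * x);
    sps_normal : normal_functional phi;
    sps_tracial : forall x y, phi (x * y) = phi (y * x);
    sps_faithful : forall x, phi (star x * x) = 0 -> x = 0 }.

Record valued_probability_space (D : set A) (E : {linear A -> A}) : Prop :=
  ValuedProbabilitySpace {
    vps_star : star_algebra;
    vps_subalgebra : unital_star_subalgebra D;
    vps_codomain : forall x, D (E x);
    vps_unit : E 1 = 1;
    vps_bimodule : forall d1 x d2, D d1 -> D d2 ->
      E (d1 * x * d2) = d1 * E x * d2 }.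

Definition scalars : set A := range (fun c : C => c%:A).
Definition scalar_expectation (phi : A -> C) (x : A) : A := (phi x)%:A.

End ProbabilitySpaces.

Definition free_with_amalgamation (R : realType) (A : algType R[i])
    (D : set A) (E : A -> A) (I : eqType) (X : I -> set A) : Prop :=
  forall w : seq (I * A),
    w != [::] ->
    (forall u, u \in w -> generated_algebra (X u.1 `|` D) u.2 /\ E u.2 = 0) ->
    sorted (fun u v => u.1 != v.1) w ->
    E (\prod_(u <- w) u.2) = 0.

Definition free_family (R : realType) (A : algType R[i]) (phi : A -> R[i])
    (I : eqType) (X : I -> set A) : Prop :=
  free_with_amalgamation (@scalars R A) (scalar_expectation phi) X.

Definition free_pair (R : realType) (A : algType R[i]) (phi : A -> R[i])
    (X Y : set A) : Prop :=
  free_family phi (fun b : bool => if b then X else Y).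

Section NoncrossingPartitions.
Variable n : nat.
Implicit Type P : {set {set 'I_n}}.

Definition noncrossing P : bool :=
  finset.partition P [set: 'I_n]%SET &&
  [forall V in P, forall W in P, (V != W) ==>
    [forall i in V, forall j in W, forall k in V, forall l in W,
      ~~ [&& i < j, j < k & k < l]%N]].

Definition NC : {set {set {set 'I_n}}} := [set P | noncrossing P]%SET.

End NoncrossingPartitions.

(* Throughout, kappa takes a tensor a_1 ⊗ ... ⊗ a_q as the list
   [:: a_1; ...; a_q]; its value on the empty list is irrelevant. *)
Section NestedProduct.
Variables (A : pzRingType) (kappa : seq A -> A) (n : nat).
(* The tensor left once some blocks have been removed: each surviving
   position, in increasing order, with the current element at that position. *)
Implicit Types (s : seq ('I_n * A)) (V : {set 'I_n}) (P : {set {set 'I_n}}).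

Definition in_block V : pred ('I_n * A) := fun u => u.1 \in V.
Definition block_part V s := filter (in_block V) s.
Definition before_block V s := take (find (in_block V) s) s.
Definition after_block V s :=
  drop (find (in_block V) s + size (block_part V s)) s.

(* V is an interval of the surviving positions p. *)
Definition is_interval V (p : seq 'I_n) : bool :=
  infix [seq i <- p | i \in V] p.

(* Multiply v into the right of the last element of l or, when l is empty,
   into the left of the first element of r. *)
Definition absorb (l : seq ('I_n * A)) (v : A) (r : seq ('I_n * A)) :=
  if rev l is (i, x) :: l' then rev l' ++ (i, x * v) :: r
  else if r is (j, y) :: r' then (j, v * y) :: r'
  else [::].

Definition remove_block V s :=
  absorb (before_block V s)
         (kappa [seq u.2 | u <- block_part V s])
         (after_block V s).

(* m is the number of blocks still to be removed before only one is left.  A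
   noncrossing partition always has an interval block, so the None
   branch is never reached from [kappa_part] on NC; when kappa is a family of
   bimodule maps the result does not depend on the block that is picked. *)
Fixpoint nested_product (m : nat) P s : A :=
  if m is m'.+1 then
    if [pick V in P | is_interval V [seq u.1 | u <- s]] is Some V
    then nested_product m' (P :\ V)%SET (remove_block V s)
    else 0
  else kappa [seq u.2 | u <- s].

Definition kappa_part P (a : n.-tuple A) : A :=
  nested_product #|P|.-1 P [seq (i, tnth a i) | i <- enum 'I_n].

End NestedProduct.

Section Uniqueness.
Variables (A : pzRingType) (n : nat).
Implicit Types (s : seq ('I_n * A)) (V W : {set 'I_n}) (P : {set {set 'I_n}}).

Lemma is_intervalP V s :
  is_interval V [seq u.1 | u <- s] -> block_part V s != [::] ->
  s = before_block V s ++ block_part V s ++ after_block V s.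
Proof.
set p := [seq u.1 | u <- s] => /infixP[p1 [p3 def_p]] part_n0.
have map_part : [seq i <- p | i \in V] = [seq u.1 | u <- block_part V s].
  by rewrite filter_map.
set q := [seq i <- p | i \in V] in def_p map_part.
have qE : q = filter (mem V) p1 ++ q ++ filter (mem V) p3.
  rewrite {1}/q def_p !filter_cat; congr (_ ++ (_ ++ _)).
  by apply/all_filterP/allP => i; rewrite mem_filter => /andP[].
have sz0 : (size (filter (mem V) p1) + size (filter (mem V) p3) = 0)%N.
  by move: (congr1 size qE); rewrite !size_cat; lia.
move/eqP: sz0; rewrite addn_eq0 => /andP[p1_0 p3_0].
have p1V : ~~ has (mem V) p1 by rewrite has_filter -size_eq0 negbK.
have p3V : ~~ has (mem V) p3 by rewrite has_filter -size_eq0 negbK.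
pose s1 := take (size p1) s; pose s2 := take (size q) (drop (size p1) s).
pose s3 := drop (size q) (drop (size p1) s).
have def_s : s = s1 ++ s2 ++ s3 by rewrite !cat_take_drop.
have s1E : [seq u.1 | u <- s1] = p1.
  by rewrite map_take -/p def_p take_size_cat.
have s2E : [seq u.1 | u <- s2] = q.
  by rewrite map_take map_drop -/p def_p drop_size_cat // take_size_cat.
have s3E : [seq u.1 | u <- s3] = p3.
  by rewrite !map_drop -/p def_p drop_size_cat // drop_size_cat.
have s1V : ~~ has (in_block V) s1 by move: p1V; rewrite -s1E has_map.
have s3V : ~~ has (in_block V) s3 by move: p3V; rewrite -s3E has_map.
have s2V : all (in_block V) s2.
  have: all (mem V) q by apply/allP => i; rewrite mem_filter => /andP[].
  by rewrite -s2E all_map.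
have partE : block_part V s = s2.
  rewrite /block_part def_s !filter_cat.
  move: s1V s3V; rewrite !has_filter !negbK => /eqP-> /eqP->.
  by rewrite cats0; apply/all_filterP.
have s2_n0 : s2 != [::] by rewrite -partE.
have findE : find (in_block V) s = size s1.
  rewrite def_s find_cat (negbTE s1V).
  by case: (s2) s2_n0 s2V => //= u t _ /andP[-> _]; rewrite addn0.
rewrite /before_block /after_block findE partE; clearbody s1 s2 s3.
have -> : take (size s1) s = s1 by rewrite def_s take_size_cat.
have -> : drop (size s1 + size s2) s = s3.
  by rewrite def_s catA drop_size_cat ?size_cat.
exact: def_s.
Qed.

Lemma interval_outside V s i :
  is_interval V [seq u.1 | u <- s] -> block_part V s != [::] -> i \notin V ->
  i \in [seq u.1 | u <- s] ->
  i \in [seq u.1 | u <- before_block V s ++ after_block V s].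
Proof.
move=> Vint Vn0 iV; rewrite {1}(is_intervalP Vint Vn0) !map_cat !mem_cat.
case/or3P=> [->//|/mapP[u]|->]; last by rewrite orbT.
rewrite mem_filter => /andP[uV _] def_i; case/negP: iV; rewrite def_i.
exact: uV.
Qed.

Lemma absorb_fst l v r : [seq u.1 | u <- @absorb A n l v r] = [seq u.1 | u <- l ++ r].
Proof.
rewrite /absorb -{2}[l]revK; case: (rev l) => [|[i x] l'] /=.
  by case: r => [|[j y] r'].
by rewrite rev_cons cat_rcons !map_cat.
Qed.

Lemma eq_nested_product (k1 k2 : seq A -> A) m P s :
  (forall t, t != [::] -> (size t < size s + (m == 0))%N -> k1 t = k2 t) ->
  s != [::] -> #|P| = m.+1 -> finset.trivIset P ->
  (forall V, V \in P -> exists2 i, i \in V & i \in [seq u.1 | u <- s]) ->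
  nested_product k1 m P s = nested_product k2 m P s.
Proof.
elim: m P s => [|m IHm] P s eqk sn0 cardP tiP meetP /=.
  by apply: eqk; [case: (s) sn0 | rewrite size_map addn1].
case: pickP => // V /andP[PV Vint].
have Vn0 : block_part V s != [::].
  have [i iV /mapP[u us def_i]] := meetP _ PV.
  rewrite -has_filter; apply/hasP; exists u => //.
  by rewrite /in_block -def_i.
have sE := is_intervalP Vint Vn0.
have cardPV : #|(P :\ V)%SET| = m.+1.
  by move: cardP; rewrite (cardsD1 V) PV => -[].
have outV i W : W \in P -> W != V -> i \in W -> i \notin V.
  move=> PW WV iW; have /finset.trivIsetP/(_ W V PW PV WV) := tiP.
  by move/disjointFr->.
have meetPV (v : A) W : W \in (P :\ V)%SET -> exists2 i, i \in W &
    i \in [seq u.1 | u <- absorb (before_block V s) v (after_block V s)].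
  rewrite !inE => /andP[WV PW]; have [i iW i_s] := meetP _ PW.
  exists i => //; rewrite absorb_fst; apply: interval_outside => //.
  exact: outV iW.
have rest_n0 : before_block V s ++ after_block V s != [::].
  have /card_gt0P[W /(meetPV 0)[i _]] : (0 < #|(P :\ V)%SET|)%N by rewrite cardPV.
  by rewrite absorb_fst; case: (_ ++ _).
have sz_rest (v : A) :
    size (absorb (before_block V s) v (after_block V s)) =
    (size (before_block V s) + size (after_block V s))%N.
  by rewrite -(size_map (fun u => u.1)) absorb_fst size_map size_cat.
have sz_s : size s = (size (before_block V s) + size (block_part V s)
                      + size (after_block V s))%N.
  by rewrite {1}sE !size_cat addnA.
have part_gt0 : (0 < size (block_part V s))%N by rewrite lt0n size_eq0.
have rest_gt0 : (0 < size (before_block V s) + size (after_block V s))%N.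
  by rewrite -size_cat lt0n size_eq0.
have -> : remove_block k1 V s = remove_block k2 V s.
  rewrite /remove_block eqk ?size_map //; last by rewrite addn0 sz_s; lia.
  by rewrite -size_eq0 size_map size_eq0.
apply: IHm => //; last 2 first.
- by apply: finset.trivIsetS tiP; apply: finset.subD1set.
- exact: meetPV.
- move=> t tn0 lt_t; apply: eqk => //; rewrite addn0.
  by move: lt_t; rewrite /remove_block sz_rest sz_s; case: (m == 0%N); lia.
by rewrite -size_eq0 /remove_block sz_rest -lt0n.
Qed.

End Uniqueness.

Section Cumulants.
Variables (R : realType) (A : algType R[i]) (D : set A) (E : A -> A).
Local Notation C := R[i].

(* kappa is, in each length n >= 1, a multilinear D-balanced map compatible
   with the outer actions of D, i.e. a D-bimodule map from the n-fold tensor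
   power of A over D to D. *)
Record bimodule_maps (kappa : seq A -> A) : Prop := BimoduleMaps {
  bm_codomain : forall s, s != [::] -> D (kappa s);
  bm_linear : forall s t (c : C) x y,
    kappa (s ++ (c *: x + y) :: t) = c *: kappa (s ++ x :: t) + kappa (s ++ y :: t);
  bm_balanced : forall s t x d y, D d ->
    kappa (s ++ [:: x * d, y & t]) = kappa (s ++ [:: x, d * y & t]);
  bm_left : forall d x s, D d -> kappa (d * x :: s) = d * kappa (x :: s);
  bm_right : forall s x d, D d ->
    kappa (rcons s (x * d)) = kappa (rcons s x) * d }.

Definition moment_cumulant (kappa : seq A -> A) : Prop :=
  forall (n : nat) (a : n.-tuple A), (0 < n)%N ->
    E (\prod_(i < n) tnth a i) = \sum_(P in NC n) kappa_part kappa P a.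

Definition cumulants (kappa : seq A -> A) : Prop :=
  bimodule_maps kappa /\ moment_cumulant kappa.

Definition star_pow (star : A -> A) (a : A) (e : bool) : A :=
  if e then star a else a.

(* (1, *, ..., 1, * ) or ( *, 1, ..., *, 1), with true encoding * . *)
Definition alternating (e : seq bool) : Prop :=
  exists k b, e = flatten (nseq k [:: b; ~~ b]).

(* w lists the pairs (d_i, s_i).  On nonempty lists kappa is unique, by
   [moment_cumulant_unique] below. *)
Definition R_diagonal (star : A -> A) (a : A) : Prop :=
  exists2 kappa, cumulants kappa &
    forall w : seq (A * bool),
      w != [::] ->
      (forall u, u \in w -> D u.1) ->
      ~ alternating [seq u.2 | u <- w] ->
      kappa [seq u.1 * star_pow star a u.2 | u <- w] = 0.

End Cumulants.

Lemma moment_cumulant_unique (R : realType) (A : algType R[i]) (E : A -> A)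
    (k1 k2 : seq A -> A) :
  moment_cumulant E k1 -> moment_cumulant E k2 ->
  forall s, s != [::] -> k1 s = k2 s.
Proof.
move=> mc1 mc2 s; move: {2}(size s).+1 (ltnSn (size s)) => N.
elim: N s => // N IHN s le_sN sn0.
have s_gt0 : (0 < size s)%N by rewrite lt0n size_eq0.
have := mc1 _ (in_tuple s) s_gt0; rewrite (mc2 _ (in_tuple s) s_gt0).
set w := [seq (i, tnth (in_tuple s) i) | i <- enum 'I_(size s)].
have w2 : [seq u.2 | u <- w] = s by rewrite -map_comp map_tnth_enum.
have w1 : [seq u.1 | u <- w] = enum 'I_(size s) by rewrite -map_comp map_id.
pose P1 := [set [set: 'I_(size s)]%SET]%SET.
have P1k (k : seq A -> A) : kappa_part k P1 (in_tuple s) = k s.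
  by rewrite /kappa_part cards1 /= -/w w2.
have w_n0 : w != [::] by rewrite -size_eq0 size_map size_enum_ord -lt0n.
have NC1 : P1 \in NC (size s).
  rewrite inE; apply/andP; split.
    rewrite /finset.partition /finset.cover big_set1 eqxx finset.trivIset1 /= inE.
    apply/eqP => /setP/(_ (Ordinal s_gt0)); by rewrite !inE.
  apply/forall_inP => V /set1P->; apply/forall_inP => W /set1P->.
  by rewrite eqxx.
rewrite (bigD1 P1 NC1) [X in _ = X -> _](bigD1 P1 NC1) !P1k.
set S2 := (X in _ + X = _ -> _); set S1 := (X in _ = _ + X -> _).
suff -> : S1 = S2 by move/addIr.
apply: eq_bigr => P /andP[NCP P_n1].
have: P \in NC (size s) by exact: NCP.
rewrite inE => /andP[/and3P[/eqP covP tiP nP0] _].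
have [m cardP] : exists m, #|P| = m.+2.
  case cP: #|P| => [|[|m]]; last by exists m.
    move/eqP: cP; rewrite cards_eq0 => /eqP P0.
    move: covP; rewrite P0 /finset.cover big_set0 => /setP/(_ (Ordinal s_gt0)).
    by rewrite !inE.
  have /cards1P[V defP] : #|P| == 1%N by rewrite cP.
  by move: covP P_n1; rewrite defP /finset.cover big_set1 => ->; rewrite eqxx.
rewrite /kappa_part cardP; apply: eq_nested_product => //.
- move=> t tn0; rewrite addn0 size_map size_enum_ord => lt_ts.
  by rewrite (IHN t) //; apply: leq_trans lt_ts _.
move=> V PV; have /set0Pn[i iV] : V != finset.set0.
  by apply: contraNneq nP0 => <-.
by exists i => //; rewrite -/w w1 mem_enum.
Qed.

Definition scalar_R_diagonal (R : realType) (A : algType R[i])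
    (phi : A -> R[i]) (star : A -> A) (a : A) : Prop :=
  R_diagonal (@scalars R A) (scalar_expectation phi) star a.

(* Main.v *)
(* Alternating words in a and a* are sorted by their first and last letters.  By
   R-diagonality over F, E vanishes on products of E-centered combinations of such
   words (with coefficients in F) in which neighbouring factors meet at two equal
   letters.  The converse holds for scalars, so it suffices to prove that phi
   vanishes on such products of phi-centered scalar words.  Words of odd length have
   expectation 0, and freeness of aa* and F makes E scalar on polynomials in aa*.
   For y = p(a*a) this fails: E y may be a nonscalar element f of F, with
   phi(f) = 0.  But in y = (y - f) + f the first summand is harmless, and f is
   surrounded by words in aa* and F only; absorbing f into them gives
   alternating products of phi-centered elements of the algebra of aa* and of F,
   framed by at most one a* on the left and one a on the right.  By freeness these
   are of the same nature as before, with fewer factors.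

   The passage between cumulants and moments evaluates a noncrossing partition by
   a stack machine, closing each block at its last element. *)
Require Import Defs.
From mathcomp Require Import zify.

Set Implicit Arguments.
Unset Strict Implicit.
Unset Printing Implicit Defensive.

Import Order.TTheory GRing.Theory Num.Theory.

(** [nested_product] removes whichever interval block [pick] returns, so no induction along the word
    can follow it. The bimodule property makes the value independent of the order; after that,
    partitions are summed letter by letter, and concatenating words means composing continuations.
    This recursion makes sense for any multilinear [kappa], whether or not it comes from an
    expectation. That freedom gives the scalar converse: the scalar cumulants are cut off just below
    one length. The cut family has vanishing centered moments because of its vanishing pattern, the
    true one by assumption, and the two differ by the cumulant of the whole word.

    Faithfulness of [phi] turns orthogonality of [x] to [F] into [E x = 0]; traciality rotates
    [star a * u * a] into [u * (a * star a)].

    Vanishing of [phi] alone is not inductive: an element of [F] at the left end of a product has a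
    neighbour on one side only, and there [E], not [phi], must kill the rest. So the main induction
    also carries a statement about [E], for products that do not both begin with [star a] and end
    with [a]. *)

(** * Alternating sequences of letters *)

Definition neqb (b c : bool) := b != c.

Definition altseq b n := mkseq (fun i => b (+) odd i) n.

Lemma altseq_cat b m n : altseq b (m + n) = altseq b m ++ altseq (b (+) odd m) n.
Proof.
rewrite /altseq /mkseq iotaD map_cat; congr (_ ++ _).
rewrite add0n -[m in iota m n]addn0 iotaDl -map_comp; apply: eq_map => i /=.
by rewrite oddD addbA.
Qed.

Lemma altseqS b n : altseq b n.+1 = b :: altseq (~~ b) n.
Proof. by rewrite -add1n altseq_cat /altseq /= addbF addbT. Qed.

Lemma size_altseq b n : size (altseq b n) = n. Proof. exact: size_mkseq. Qed.

Lemma altseq_sorted b n : sorted neqb (altseq b n).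
Proof.
case: n b => [//|n] b; rewrite altseqS /=.
elim: n b => [//|n IHn] b; rewrite altseqS /= IHn /neqb.
by case: (b).
Qed.

Lemma sorted_altseq b e : sorted neqb e -> head b e = b -> e = altseq b (size e).
Proof.
elim: e b => [//|c e IHe] b /= p_e def_c; subst c; rewrite altseqS; congr (_ :: _).
apply: IHe; first by apply: path_sorted p_e.
by case: e p_e => [//|d e] /= /andP[]; rewrite /neqb; case: (b) (d) => [] [].
Qed.

Lemma last_altseq b c n : last c (altseq b n) = if n is n'.+1 then b (+) odd n' else c.
Proof. by case: n => [//|n]; rewrite -[in LHS]addn1 altseq_cat last_cat /= addbF. Qed.

Lemma last_sorted b e : sorted neqb (b :: e) -> last b e = b (+) odd (size e).
Proof. by move=> sE; have /(congr1 (last b)) := @sorted_altseq b _ sE erefl;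
  rewrite last_altseq. Qed.

Lemma head_altseq b n : head b (altseq b n) = b.
Proof. by case: n => [//|n]; rewrite altseqS. Qed.

(** The letters on the two sides of an even block are different, so closing the block keeps the
    alternation. Using [b] and [c] as defaults of [head] and [last] keeps the end conditions valid
    when nothing is left. *)
Lemma sorted_remove_even b c e1 e2 e3 : ~~ odd (size e2) ->
  sorted neqb (e1 ++ e2 ++ e3) -> head b (e1 ++ e2 ++ e3) = b ->
  last c (e1 ++ e2 ++ e3) = c ->
  [/\ sorted neqb (e1 ++ e3), head b (e1 ++ e3) = b & last c (e1 ++ e3) = c].
Proof.
move=> ev2 sE hE; have := sorted_altseq sE hE.
rewrite !size_cat !altseq_cat => def_e.
have e1E : e1 = altseq b (size e1).
  by have := congr1 (take (size e1)) def_e; rewrite !take_size_cat // size_altseq.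
have e23E : e2 ++ e3 = altseq (b (+) odd (size e1)) (size e2) ++
    altseq (b (+) odd (size e1) (+) odd (size e2)) (size e3).
  by have := congr1 (drop (size e1)) def_e; rewrite !drop_size_cat // size_altseq.
have e3E : e3 = altseq (b (+) odd (size e1)) (size e3).
  have := congr1 (drop (size e2)) e23E; rewrite !drop_size_cat ?size_altseq //.
  by rewrite (negbTE ev2) addbF.
have -> : e1 ++ e3 = altseq b (size e1 + size e3) by rewrite altseq_cat -e1E -e3E.
rewrite def_e -!altseq_cat !last_altseq => lE.
split; [exact: altseq_sorted | exact: head_altseq | move: lE].
case def_n: (size e1 + size e3)%N => [//|j].
have -> : (size e1 + (size e2 + size e3) = (j + size e2).+1)%N by lia.
by rewrite oddD (negbTE ev2) addbF.
Qed.

(** * Shift-reduce evaluation *)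

Section ShiftReduce.
Variables (K : comNzRingType) (A : algType K).
Implicit Types (kappa k : seq A -> A) (l m s t u : seq A).

Definition multilinear (f : seq A -> A) : Prop :=
  forall s t (c : K) x y,
    f (s ++ (c *: x + y) :: t) = c *: f (s ++ x :: t) + f (s ++ y :: t).

Definition push_value k l (d : A) : A :=
  if l is y :: l' then k (y * d :: l') else d * k [::].

(* Reads u onto the stack l (top first).  After each letter the q + 1 topmost
   ones may be closed into a block, whose value is pushed to the right of the
   new top, or out to the left of everything when the stack is empty.  The
   continuation k evaluates the final stack.  With [k := empty_stack] the choices
   made correspond to the noncrossing partitions of the input. *)
Fixpoint shift_reduce kappa k l u : A :=
  if u is x :: u' then
    shift_reduce kappa k (x :: l) u' +
    \sum_(0 <= q < (size l).+1)
      push_value (fun l' => shift_reduce kappa k l' u') (drop q l) (kappa (rev (x ::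
        take q l)))
  else k l.

Definition empty_stack l : A := (nilp l)%:R.

Definition moment kappa u : A := shift_reduce kappa empty_stack [::] u.

Lemma multilinear0 f s t : multilinear f -> f (s ++ 0 :: t) = 0.
Proof.
move=> fL; have := fL s t 1 0 0; rewrite scaler0 addr0 scale1r.
by move/(congr1 (fun z => z - f (s ++ 0 :: t))); rewrite addrK subrr.
Qed.

Lemma multilinearZ f s t c x :
  multilinear f -> f (s ++ (c *: x) :: t) = c *: f (s ++ x :: t).
Proof.
by move=> fL; have := fL s t c x 0; rewrite addr0 (multilinear0 _ _ fL) addr0.
Qed.

Lemma empty_stack_multilinear : multilinear empty_stack.
Proof.
move=> s t c x y; have E z : empty_stack (s ++ z :: t) = 0.
  by rewrite /empty_stack /nilp size_cat addnS.
by rewrite !E scaler0 addr0.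
Qed.

Lemma push_value_linear k l c x y : multilinear k ->
  push_value k l (c *: x + y) = c *: push_value k l x + push_value k l y.
Proof.
move=> kL; case: l => [|z l] /=; first by rewrite mulrDl scalerAl.
by rewrite mulrDr -scalerAr (kL [::]).
Qed.

Lemma push_value0 k l : multilinear k -> push_value k l 0 = 0.
Proof.
move=> kL; case: l => [|z l] /=; first by rewrite mul0r.
by rewrite mulr0 (multilinear0 [::]).
Qed.

Lemma push_valueD k l x y : multilinear k -> push_value k l (x + y) =
  push_value k l x + push_value k l y.
Proof. by move=> kL; have := push_value_linear l 1 x y kL; rewrite !scale1r. Qed.

Lemma push_value_sum k l (I : Type) (r : seq I) (F : I -> A) : multilinear k ->
  push_value k l (\sum_(i <- r) F i) = \sum_(i <- r) push_value k l (F i).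
Proof.
move=> kL; elim: r => [|i r IHr]; first by rewrite !big_nil push_value0.
by rewrite !big_cons push_valueD // IHr.
Qed.

Lemma push_value1 k l : push_value k l 1 = k l.
Proof. by case: l => [|y l] /=; rewrite ?mul1r ?mulr1. Qed.

Lemma shift_reduce_multilinear kappa k u :
  multilinear kappa -> multilinear k -> multilinear (shift_reduce kappa k ^~ u).
Proof.
move=> kappaL kL; elim: u => [|x0 u IHu] s t c x y /=; first exact: kL.
rewrite (IHu (x0 :: s)) !size_cat /= scalerDr addrACA; congr (_ + _).
rewrite scaler_sumr -big_split /=; apply: eq_big_nat => q /andP[_ le_q].
(* The altered letter stays below the new top, becomes the new top, or lies in the closed block. *)
have [lt_qs|le_sq] := ltnP q (size s).
  rewrite !drop_cat !take_cat !lt_qs.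
  have: drop q s != [::] by rewrite -size_eq0 size_drop subn_eq0 -ltnNge.
  by case: (drop q s) => //= z s' _; apply: (IHu (_ :: s')).
rewrite !drop_cat !take_cat !ltnNge !le_sq /=.
case: (q - size s)%N => [|j] /=.
  by rewrite !cats0 mulrDl -scalerAl (IHu [::]).
rewrite !rev_cons !rev_cat !rev_cons -!cats1 -!catA /=.
by rewrite kappaL push_value_linear.
Qed.

Lemma shift_reduce_input_multilinear kappa k l : multilinear kappa -> multilinear k ->
  multilinear (shift_reduce kappa k l).
Proof.
move=> kappaL kL s; elim: s l => [|x0 s IHs] l t c x y /=.
  rewrite (shift_reduce_multilinear _ kappaL kL [::]) scalerDr addrACA; congr (_ + _).
  rewrite scaler_sumr -big_split /=; apply: eq_bigr => q _.
  by rewrite !rev_cons -!cats1 kappaL push_value_linear //; apply: shift_reduce_multilinear.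
rewrite IHs scalerDr addrACA; congr (_ + _).
rewrite scaler_sumr -big_split /=; apply: eq_bigr => q _.
by case: (drop q l) => [|z l'] /=; rewrite IHs // mulrDr scalerAr.
Qed.

Lemma moment_multilinear kappa : multilinear kappa -> multilinear (moment kappa).
Proof.
by move=> kL; apply: shift_reduce_input_multilinear => //; apply: empty_stack_multilinear.
Qed.

(** This is what the continuation is for: the second word sees the first one only through the stack
    it leaves. *)
Lemma shift_reduce_cat kappa k l u v :
  shift_reduce kappa k l (u ++ v) = shift_reduce kappa (fun l' => shift_reduce kappa k
    l' v) l u.
Proof.
elim: u l => [//|x u IHu] l /=; rewrite IHu; congr (_ + _).
by apply: eq_bigr => q _; case: (drop q l) => [|z l'] /=; rewrite IHu.
Qed.

Lemma shift_reduceB kappa k1 k2 l u :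
  shift_reduce kappa (fun l' => k1 l' - k2 l') l u =
    shift_reduce kappa k1 l u - shift_reduce kappa k2 l u.
Proof.
elim: u l => [//|x u IHu] l /=; rewrite IHu opprD addrACA; congr (_ + _).
rewrite -sumrB; apply: eq_bigr => q _.
by case: (drop q l) => [|z l'] /=; rewrite IHu // mulrBr.
Qed.

(* Formal version of the moment of a product of centered words, in which
   kappa need not be the cumulants of anything. *)
Fixpoint centered_reduce kappa (ws : seq (seq A)) l : A :=
  if ws is w :: ws' then
    shift_reduce kappa (centered_reduce kappa ws') l w - push_value (centered_reduce
      kappa ws') l (moment kappa w)
  else empty_stack l.

Lemma centered_reduce_multilinear kappa ws : multilinear kappa ->
  multilinear (centered_reduce kappa ws).
Proof.
move=> kL; elim: ws => [|w ws IHws] /=; first exact: empty_stack_multilinear.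
move=> s t c x y; rewrite (shift_reduce_multilinear w kL IHws) scalerBr addrACA.
congr (_ + _); rewrite -opprD; congr (- _).
case: s => [|z s] /=; last by rewrite (IHws (_ :: s)).
by rewrite mulrDl -scalerAl (IHws [::]).
Qed.

Section Alternation.
Variables (D : set A) (L : bool -> set A) (kappa : seq A -> A).

Fixpoint typed (e : seq bool) s : Prop :=
  match e, s with
  | [::], [::] => True
  | b :: e', x :: s' => L b x /\ typed e' s'
  | _, _ => False
  end.

Lemma typed_cat e1 e2 s1 s2 :
  typed e1 s1 -> typed e2 s2 -> typed (e1 ++ e2) (s1 ++ s2).
Proof.
by elim: e1 s1 => [|b e1 IHe] [|x s1] //= [Lx /IHe es1 /es1].
Qed.

Lemma typed_rev e s : typed e s -> typed (rev e) (rev s).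
Proof.
elim: e s => [|b e IHe] [|x s] //= [Lx es].
by rewrite !rev_cons -!cats1; apply: typed_cat => //=; apply: IHe.
Qed.

Lemma typed_take q e s : typed e s -> typed (take q e) (take q s).
Proof.
by elim: e s q => [|b e IHe] [|x s] [|q] //= [Lx /IHe].
Qed.

Lemma typed_drop q e s : typed e s -> typed (drop q e) (drop q s).
Proof.
by elim: e s q => [|b e IHe] [|x s] [|q] //= [Lx /IHe].
Qed.

Lemma typed_size e s : typed e s -> size e = size s.
Proof. by elim: e s => [|b e IHe] [|x s] //= [_ /IHe->]. Qed.

Hypothesis L_right : forall b x d, L b x -> D d -> L b (x * d).
Hypothesis kappaD : forall s, s != [::] -> D (kappa s).
Hypothesis kappaL : multilinear kappa.
Hypothesis kappa0 : forall e s, typed e s -> s != [::] ->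
  ~~ (~~ odd (size e) && sorted neqb e) -> kappa s = 0.

(* A block reaching from the word into the stack l would contain two equal
   neighbouring letters, so the word contributes its moment unless some of its
   letters stay on the stack, where k then kills them. *)
Lemma shift_reduce_split b c k l el m em u eu :
  multilinear k ->
  (forall t et, typed et t -> t != [::] -> head c et = c -> k t = 0) ->
  typed el l -> typed em m -> typed eu u ->
  sorted neqb (rev em ++ eu) -> head b (rev em ++ eu) = b ->
  last c (rev em ++ eu) = c -> head b el = b ->
  shift_reduce kappa k (m ++ l) u = push_value k l (shift_reduce kappa empty_stack m u).
Proof.
move=> kL k0; elim: u eu l el m em => [|x u IHu] [|s eu] l el m em //=.
  move=> Tl Tm _; rewrite cats0 => _ _ last_c _.
  case: m Tm => [|y m] Tm; first by rewrite /empty_stack push_value1.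
  rewrite [empty_stack _]/empty_stack push_value0 //; apply: (k0 _ (em ++ el)) => //.
    exact: typed_cat.
  by case: em Tm last_c => //= ? em _; rewrite rev_cons last_rcons.
move=> Tl Tm [Lx Tu] sE hE lE hl.
have srL := shift_reduce_multilinear u kappaL kL.
rewrite push_valueD // push_value_sum //; congr (_ + _).
  rewrite -(IHu eu l el (x :: m) (s :: em)) //=.
  - by rewrite rev_cons cat_rcons.
  - by rewrite rev_cons cat_rcons.
  by rewrite rev_cons cat_rcons.
rewrite size_cat -addSn (big_cat_nat (n := (size m).+1)) ?leq_addr //=.
rewrite [X in _ + X]big_nat_cond [X in _ + X]big1 ?addr0; last first.
  move=> q /andP[/andP[lt_mq lt_q] _].
  rewrite drop_cat take_cat ltnNge ltnW //=.
  rewrite (@kappa0 (rev (s :: em ++ take (q - size m) el))) ?push_value0 //.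
  - by apply: typed_rev; split=> //; apply: typed_cat => //; apply: typed_take.
  - by rewrite -size_eq0 size_rev.
  rewrite negb_and; apply/orP; right.
  have: (0 < size el)%N by rewrite (typed_size Tl); lia.
  case: el Tl hl => [//|b' el] Tl /= hl _; subst b'.
  have -> : (q - size m = (q - size m).-1.+1)%N by lia.
  rewrite /= -cat_cons rev_cat rev_cons.
  have: exists e, rev (s :: em) = b :: e.
    move: hE; rewrite rev_cons.
    case: (rev em) => [|b' e] /= ->; first by exists [::].
    by exists (rcons e s).
  case=> e ->; apply/negP; rewrite cat_rcons.
  by case: (rev _) => [|c' r] /=; rewrite ?cat_path /= /neqb eqxx ?andbF.
rewrite [LHS]big_nat_cond [RHS]big_nat_cond; apply: eq_bigr => q.
rewrite andbT => /andP[_ le_qm].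
rewrite takel_cat //.
have -> : drop q (m ++ l) = drop q m ++ l.
  rewrite drop_cat; case: ltnP => // le_mq.
  have -> : q = size m by apply/eqP; rewrite eqn_leq le_mq andbT.
  by rewrite subnn drop0 drop_size.
have Tv : typed (s :: take q em) (x :: take q m) by split=> //; apply: typed_take.
set v := kappa _.
(* Odd blocks vanish; an even one leaves an alternating word with the same end conditions, to which
   induction applies. *)
have [evA|oddA] := boolP (~~ odd (size (s :: take q em))); last first.
  have -> : v = 0.
    apply: (kappa0 (typed_rev Tv)); first by rewrite -size_eq0 size_rev.
    by rewrite size_rev /= negb_and oddA.
  by rewrite !push_value0 //; apply: shift_reduce_multilinear => //;
    apply: empty_stack_multilinear.
have vD : D v by apply: kappaD; rewrite -size_eq0 size_rev.
have SE : rev em ++ s :: eu =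
    rev (drop q em) ++ rev (s :: take q em) ++ eu.
  by rewrite -[in LHS](cat_take_drop q em) rev_cat rev_cons cat_rcons catA.
rewrite SE in sE hE lE.
have ev : ~~ odd (size (rev (s :: take q em))) by rewrite size_rev.
have [sE' hE' lE'] := sorted_remove_even ev sE hE lE.
have := typed_drop q Tm; case dm: (drop q m) => [|y m'] /=;
  case de: (drop q em) => [|b' e'] // Td;
  rewrite de in sE' hE' lE'.
  (* The block uses up [m]: its value goes to the top of [l] or, if [l] is empty, to the front. *)
  case: l el Tl hl => [|y l] [|b' el] //=.
    by move=> _ _; rewrite -[in LHS](cat0s [::]) (IHu eu [::] [::] [::] [::]) //= mulrA.
  move=> [Ly Tl] def_b; rewrite -[_ :: l](cat0s) (IHu eu _ (b' :: el) [::] [::]) //=.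
    by rewrite mulrA.
  by split=> //; apply: L_right.
case: Td => Ly Td.
rewrite (IHu eu l el (y * v :: m') (b' :: e')) //; split=> //; exact: L_right.
Qed.

(** Blocks of odd length have value 0, so the parity of the number of unclosed letters is invariant,
    and an odd number never ends at the empty stack. *)
Lemma shift_reduce_odd e em w m : typed em m -> typed e w -> odd (size m + size w) ->
  shift_reduce kappa empty_stack m w = 0.
Proof.
elim: w e em m => [|x u IHu] [|s e] em m //= Tm.
  by move=> _; rewrite addn0 /empty_stack /nilp; case: (size m).
move=> [Lx Tu] odd_mu; rewrite (IHu e (s :: em)) ?addSnnS //.
rewrite add0r big_nat_cond big1 // => q; rewrite andbT => /andP[_ le_qm].
have Tv : typed (s :: take q em) (x :: take q m) by split=> //; apply: typed_take.
set v := kappa _.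
have [evA|oddA] := boolP (~~ odd (size (x :: take q m))); last first.
  have -> : v = 0.
    apply: (kappa0 (typed_rev Tv)); first by rewrite -size_eq0 size_rev.
    by rewrite size_rev (typed_size Tv) negb_and oddA.
  by rewrite push_value0 //; apply: shift_reduce_multilinear => //;
    apply: empty_stack_multilinear.
have vD : D v by apply: kappaD; rewrite -size_eq0 size_rev.
have odd_rest : odd (size (drop q m) + size u).
  move: odd_mu evA; rewrite size_drop /= size_takel // addnS /= negbK !oddD oddB //.
  by case: (odd (size u)) (odd (size m)) (odd q) => [] [] [].
have := typed_drop q Tm.
case: (drop q m) odd_rest => [|y m'] odd_rest; case: (drop q em) => [|b e'] // Td /=.
  by rewrite (IHu e [::]) ?mulr0.
case: Td => Ly Td; rewrite (IHu e (b :: e')) //=; split=> //; exact: L_right.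
Qed.

Lemma moment_odd e w : typed e w -> odd (size w) -> moment kappa w = 0.
Proof. exact: (@shift_reduce_odd e [::] w [::]). Qed.

(* Consecutive words meet at two equal letters: the last letter of each word
   is the first letter of the next, and [o] is the letter before the words. *)
Fixpoint chained (o : option bool) (es : seq (seq bool)) : bool :=
  if es is e :: es' then
    if e is b :: e' then
      [&& path neqb b e', oapp (eq_op b) true o & chained (Some (last b e')) es']
    else false
  else true.

Fixpoint typed_words (es : seq (seq bool)) (ws : seq (seq A)) : Prop :=
  match es, ws with
  | [::], [::] => True
  | e :: es', w :: ws' => typed e w /\ typed_words es' ws'
  | _, _ => False
  end.

(** The induction hypothesis is the assumption on [k] in [shift_reduce_split]: the remaining words
    kill any nonempty stack whose top letter is the last letter of the first word. Hence this word
    contributes its moment, and the centering subtracts exactly that. *)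
Lemma centered_reduce_chained es ws el l : typed_words es ws -> typed el l ->
  chained (ohead el) es -> (es != [::]) || (l != [::]) -> centered_reduce kappa ws l = 0.
Proof.
elim: ws es l el => [|w ws IHws] [|e es] l el //=.
  by move=> _ _ _; rewrite /empty_stack /nilp size_eq0 => /negbTE->.
move=> [Tw Tws] Tl; case: e Tw => [//|b e] Tw /and3P[p_e o_el ch_es] _.
rewrite -(cat0s l) (@shift_reduce_split b (last b e) _ l el [::] [::] w (b :: e)) //.
- by rewrite subrr.
- exact: centered_reduce_multilinear.
- move=> t et Tt t0 ht; apply: (IHws es t et) => //; last by rewrite t0 orbT.
  by case: et Tt ht => [|b' et] Tt /= ht; [case: (t) t0 Tt | rewrite ht].
by case: (el) o_el => [|b' el'] //= /eqP.
Qed.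

End Alternation.
End ShiftReduce.

(** * Independence of the order of block removal *)

Section Confluence.
Variables (R : realType) (A : algType R[i]) (D : set A) (kappa : seq A -> A).
Hypothesis bm : bimodule_maps D kappa.
Variable n : nat.
Implicit Types (s l b m c r : seq ('I_n * A)) (V W : {set 'I_n}).
Implicit Types P : {set {set 'I_n}}.

Local Notation disj V W := (fintype.disjoint (mem V) (mem W)).

Definition splits V l b r : bool :=
  [&& all (in_block V) b, b != [::], ~~ has (in_block V) l & ~~ has (in_block V) r].

Lemma remove_blockE V l b r : splits V l b r ->
  remove_block kappa V (l ++ b ++ r) = absorb l (kappa [seq u.2 | u <- b]) r.
Proof.
case/and4P=> bV bn0 lV rV.
have partE : block_part V (l ++ b ++ r) = b.
  rewrite /block_part !filter_cat.
  move: lV rV; rewrite !has_filter !negbK => /eqP-> /eqP->.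
  by rewrite cats0; apply/all_filterP.
have findE : find (in_block V) (l ++ b ++ r) = size l.
  rewrite find_cat (negbTE lV).
  by case: (b) bn0 bV => //= u t _ /andP[-> _]; rewrite addn0.
rewrite /remove_block /before_block /after_block partE findE take_size_cat //.
by rewrite catA drop_size_cat // size_cat.
Qed.

Lemma splits_interval V l b r s : splits V l b r ->
  [seq u.1 | u <- s] = [seq u.1 | u <- l ++ b ++ r] ->
  is_interval V [seq u.1 | u <- s].
Proof.
case/and4P=> bV bn0 lV rV ->; rewrite /is_interval filter_map.
have -> : [seq x <- l ++ b ++ r | preim fst (fun i => i \in V) x] = b.
  rewrite !filter_cat; move: lV rV; rewrite !has_filter !negbK.
  by move=> /eqP-> /eqP->; rewrite cats0; apply/all_filterP.
by rewrite !map_cat; apply/infixP; eexists; eexists.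
Qed.

Lemma interval_splits V s : is_interval V [seq u.1 | u <- s] ->
  has (in_block V) s -> exists l b r, s = l ++ b ++ r /\ splits V l b r.
Proof.
move=> Vint Vs; have Vn0 : block_part V s != [::] by rewrite -has_filter.
have sE := is_intervalP Vint Vn0.
exists (before_block V s), (block_part V s), (after_block V s); split=> //.
rewrite /splits Vn0 filter_all /= !has_filter !negbK -!size_eq0.
have: size (filter (in_block V) s) = size (block_part V s) by [].
rewrite {1}sE !filter_cat !size_cat.
have -> : filter (in_block V) (block_part V s) = block_part V s.
  exact/all_filterP/filter_all.
by move/eqP; rewrite addnCA -[X in _ == X]addn0 eqn_add2l addn_eq0.
Qed.

Lemma absorb_rcons l i x v r :
  absorb (rcons l (i, x)) v r = l ++ (i, x * v) :: r.
Proof. by rewrite /absorb rev_rcons revK. Qed.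

Lemma kappa_rcons b (u : 'I_n * A) d : D d ->
  kappa [seq v.2 | v <- rcons b (u.1, u.2 * d)] =
  kappa [seq v.2 | v <- rcons b u] * d.
Proof. by move=> Dd; rewrite !map_rcons /= (bm_right bm). Qed.

Lemma kappa_cons b (u : 'I_n * A) d : D d ->
  kappa [seq v.2 | v <- (u.1, d * u.2) :: b] = d * kappa [seq v.2 | v <- u :: b].
Proof. by move=> Dd; rewrite /= (bm_left bm). Qed.

Lemma hasN_disjoint V W b : all (in_block V) b -> disj V W ->
  ~~ has (in_block W) b.
Proof.
move=> /allP bV VW; apply/hasPn => u /bV; rewrite /in_block => uV.
by rewrite (disjointFr VW).
Qed.

Lemma two_splits V W l b r l' c r' : disj V W ->
  splits V l b r -> splits W l' c r' -> l ++ b ++ r = l' ++ c ++ r' ->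
  (size l <= size l')%N -> exists m, l' = l ++ b ++ m /\ r = m ++ c ++ r'.
Proof.
move=> VW /and4P[bV bn0 lV rV] /and4P[cW cn0 lW rW] eq_s le_l.
have l'E : l' = l ++ drop (size l) l'.
  rewrite -[LHS](cat_take_drop (size l)); congr (_ ++ _).
  have := congr1 (take (size l)) eq_s.
  by rewrite take_size_cat // takel_cat.
set t := drop _ _ in l'E; move: eq_s; rewrite l'E -catA => /eqP.
rewrite eqseq_cat // eqxx /= => /eqP eq_t.
have le_b : (size b <= size t)%N.
  rewrite leqNgt; apply/negP => lt_t.
  have := congr1 (drop (size t)) eq_t; rewrite [RHS]drop_size_cat // drop_cat lt_t.
  have := drop_nth; case db: (drop (size t) b) => [|u b'] _.
    by move: (congr1 size db); rewrite size_drop /=; lia.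
  case: c cn0 cW {eq_t} => [//|w c] _ /= /andP[wW _] [def_u _]; subst w.
  have: u \in b by rewrite -(cat_take_drop (size t) b) mem_cat db mem_head orbT.
  move/(allP bV); rewrite /in_block => uV.
  by move: wW; rewrite /in_block (disjointFr VW uV).
have tE : t = b ++ drop (size b) t.
  rewrite -[LHS](cat_take_drop (size b)); congr (_ ++ _).
  have := congr1 (take (size b)) eq_t.
  by rewrite take_size_cat // takel_cat.
exists (drop (size b) t); split; first by rewrite -tE.
by move: eq_t; rewrite tE -catA drop_size_cat // => /eqP; rewrite eqseq_cat // eqxx /= => /eqP.
Qed.

(** With a survivor between the blocks, the two values enter different letters or opposite sides of
    one letter. If the blocks are adjacent, the value of one may enter an end letter of the other;
    the bimodule property pulls it out, and both orders leave the product of the two values. Some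
    letter must survive for [absorb] to have a place for the value. *)
Lemma remove_blocksC V W l b m c r : disj V W ->
  splits V l b (m ++ c ++ r) -> splits W (l ++ b ++ m) c r ->
  let s := l ++ b ++ m ++ c ++ r in
  l ++ m ++ r != [::] ->
  remove_block kappa W (remove_block kappa V s) =
  remove_block kappa V (remove_block kappa W s).
Proof.
move=> VW splV splW s rest_n0.
case/and4P: (splV) => bV bn0 lV; rewrite !has_cat !negb_or => /and3P[mV cV rV].
case/and4P: (splW) => cW cn0; rewrite !has_cat !negb_or => /and3P[lW bW mW] rW.
have Dk t : t != [::] -> D (kappa [seq u.2 | u <- t]).
  by move=> tn0; apply: (bm_codomain bm); rewrite -size_eq0 size_map size_eq0.
set v := kappa [seq u.2 | u <- b]; set w := kappa [seq u.2 | u <- c].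
have Dv : D v by exact: Dk. have Dw : D w by exact: Dk.
have -> : remove_block kappa V s = absorb l v (m ++ c ++ r).
  exact: remove_blockE.
have -> : remove_block kappa W s = absorb (l ++ b ++ m) w r.
  by rewrite -(remove_blockE splW) /s -!catA.
clear splV splW s.
case/lastP: m mW mV rest_n0 => [|m [k z]] mW mV rest_n0.
  rewrite cats0 /=.
  case/lastP: b bn0 bV @v Dv bW => [//|b [i x]] _ bV v Dv bW.
  rewrite -rcons_cat absorb_rcons -catA.
  have splV' r' : ~~ has (in_block V) r' -> splits V l (rcons b (i, x * w)) r'.
    move=> r'V; rewrite /splits -size_eq0 size_rcons lV r'V !andbT /=.
    by move: bV; rewrite !all_rcons.
  rewrite -cat_rcons remove_blockE; last exact: splV'.
  rewrite (@kappa_rcons b (i, x)) // -/v.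
  case/lastP: l lW {lV splV'} rest_n0 => [|l [j y]] lW rest_n0.
    case: c cn0 cW @w Dw cV => [//|[j y] c] _ cW w Dw cV /=.
    rewrite (@remove_blockE W [::] ((j, v * y) :: c) r); last first.
      by apply/and4P; split.
    rewrite (@kappa_cons c (j, y)) // -/w.
  rewrite !absorb_rcons -cat_rcons remove_blockE; last first.
    apply/and4P; split=> //; first by move: lW; rewrite !has_rcons.
  by rewrite -/w absorb_rcons mulrA.
have RHS_E : remove_block kappa V (absorb (l ++ b ++ rcons m (k, z)) w r) =
    absorb l v (rcons m (k, z * w) ++ r).
  rewrite -!rcons_cat absorb_rcons -!catA -cat_rcons remove_blockE //.
  apply/and4P; split=> //; rewrite has_cat negb_or rV andbT.
  by move: mV; rewrite !has_rcons.
rewrite {}RHS_E.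
have shift t y : ~~ has (in_block W) (rcons t (k, y)) ->
    remove_block kappa W (rcons t (k, y) ++ c ++ r) = t ++ (k, y * w) :: r.
  by move=> tW; rewrite remove_blockE ?absorb_rcons //; apply/and4P; split.
case/lastP: l lW lV {rest_n0} => [|l [j y]] lW lV.
  case: m mW {mV} => [|[i x] m] /= mW.
    by rewrite (shift [::] (v * z) mW) /absorb /= mulrA.
  by rewrite (shift ((i, v * x) :: m) z mW) cat_rcons.
rewrite !absorb_rcons.
have -> : l ++ (j, y * v) :: rcons m (k, z) ++ c ++ r =
    rcons (l ++ (j, y * v) :: m) (k, z) ++ c ++ r.
  by rewrite rcons_cat -catA.
rewrite shift; first by rewrite -catA cat_rcons.
move: lW mW; rewrite !has_rcons has_cat /= !negb_or.
by move=> /andP[-> ->] /andP[-> ->].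
Qed.


Definition partitions P (p : seq 'I_n) : Prop :=
  [/\ finset.trivIset P, forall V, V \in P -> has (mem V) p
    & forall i, i \in p -> exists2 V, V \in P & i \in V].

Lemma partitions_disjoint P p V W : partitions P p -> V \in P -> W \in P -> V != W ->
  disj V W.
Proof. by case=> /finset.trivIsetP tiP _ _ PV PW; apply: tiP. Qed.

Lemma partitions_remove P V l b r : splits V l b r -> V \in P ->
  partitions P [seq u.1 | u <- l ++ b ++ r] ->
  partitions (P :\ V)%SET [seq u.1 | u <- l ++ r].
Proof.
case/and4P=> bV _ lV rV PV valP; have [tiP meetP covP] := valP; split.
- by apply: finset.trivIsetS tiP; apply: finset.subD1set.
- move=> W; rewrite !inE => /andP[WV PW]; move: (meetP _ PW).
  rewrite !map_cat !has_cat; case/or3P=> [->//||->]; last by rewrite orbT.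
  have VW : disj V W by apply: partitions_disjoint valP PV PW _; rewrite eq_sym.
  by rewrite has_map => bW; case/negP: (hasN_disjoint bV VW).
move=> i lr_i; have [|W PW iW] := covP i.
  by move: lr_i; rewrite !map_cat !mem_cat => /orP[->|->]; rewrite ?orbT.
exists W => //; rewrite !inE PW andbT; apply: contraTneq lr_i => WV; subst W.
rewrite map_cat mem_cat negb_or; apply/andP; split; apply/mapP => -[u us def_i].
  by case/negP: (hasPn lV u us); rewrite /in_block -def_i.
by case/negP: (hasPn rV u us); rewrite /in_block -def_i.
Qed.

(** The case without survivors: both sides are the value of [b] times the value of [c], one by the
    left and one by the right module property. *)
Lemma kappa_remove2 V W b c : disj V W -> splits V [::] b c -> splits W b c [::] ->
  kappa [seq u.2 | u <- remove_block kappa V (b ++ c)] =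
  kappa [seq u.2 | u <- remove_block kappa W (b ++ c)].
Proof.
move=> VW splV splW.
have -> := remove_blockE splV; have := remove_blockE splW; rewrite cats0 => ->.
case/and4P: splV splW => bV bn0 _ _ /and4P[cW cn0 _ _].
have Dk t : t != [::] -> D (kappa [seq u.2 | u <- t]).
  by move=> tn0; apply: (bm_codomain bm); rewrite -size_eq0 size_map size_eq0.
set v := kappa [seq u.2 | u <- b]; set w := kappa [seq u.2 | u <- c].
have Dv : D v by exact: (Dk _ b). have Dw : D w by exact: (Dk _ c).
case/lastP: b bn0 bV @v Dv => [//|b [i x]] _ bV v Dv.
case: c cn0 cW @w Dw => [//|[j y] c] _ cW w Dw.
rewrite absorb_rcons -cat_rcons cats0 (@kappa_rcons b (i, x)) //.
by rewrite /absorb [rev _]/= (@kappa_cons c (j, y)).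
Qed.

Definition removable j : Prop := forall P V s, #|P| = j.+2 ->
  partitions P [seq u.1 | u <- s] -> V \in P -> is_interval V [seq u.1 | u <- s] ->
  nested_product kappa j.+1 P s =
  nested_product kappa j (P :\ V)%SET (remove_block kappa V s).

(** A diamond argument: by induction each side may remove the other block next, and the two removals
    commute. When these are the only two blocks, no letter survives and [kappa_remove2] takes
    over. *)
Lemma nested_product_swap j P U1 U2 l b t c r :
  (forall j', j = j'.+1 -> removable j') ->
  let s := l ++ b ++ t ++ c ++ r in
  #|P| = j.+2 -> partitions P [seq u.1 | u <- s] ->
  U1 \in P -> U2 \in P -> U1 != U2 ->
  splits U1 l b (t ++ c ++ r) -> splits U2 (l ++ b ++ t) c r ->
  nested_product kappa j (P :\ U1)%SET (remove_block kappa U1 s) =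
  nested_product kappa j (P :\ U2)%SET (remove_block kappa U2 s).
Proof.
move=> IH s cardP valP P1 P2 U12 spl1 spl2.
have D12 := partitions_disjoint valP P1 P2 U12.
have sE2 : s = (l ++ b ++ t) ++ c ++ r by rewrite /s -!catA.
have P12 : U2 \in (P :\ U1)%SET by rewrite !inE P2 eq_sym U12.
have card12 : #|(P :\ U1 :\ U2)%SET| = j.
  by move: cardP; rewrite (cardsD1 U1) P1 (cardsD1 U2) P12 !add1n => -[->].
have DC : (P :\ U2 :\ U1)%SET = (P :\ U1 :\ U2)%SET.
  by apply/setP => U; rewrite !inE andbCA.
case: j IH cardP card12 => [|j] IH cardP card12.
  have PE U : U \in P -> U = U1 \/ U = U2.
    move=> PU; have : (P :\ U1 :\ U2)%SET == finset.set0 by rewrite -cards_eq0 card12.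
    move/eqP/setP/(_ U); rewrite !inE PU andbT => /negbT; rewrite negb_and !negbK.
    by case/orP=> /eqP; [right | left].
  have rest0 u : u \in l ++ t ++ r -> False.
    have [_ _ covP] := valP => us.
    have [|U PU uU] := covP u.1.
      rewrite /s; apply/map_f; move: us; rewrite !mem_cat.
      by case/or3P=> ->; rewrite ?orbT.
    case/and4P: spl1 => _ _ l1; rewrite !has_cat !negb_or => /and3P[t1 _ r1].
    case/and4P: spl2 => _ _; rewrite !has_cat !negb_or => /and3P[l2 _ t2] r2.
    move: us; rewrite !mem_cat; case: (PE _ PU) uU => -> uU.
      by case/or3P=> us; [move: l1|move: t1|move: r1] => /hasPn/(_ u us)/negP[].
    by case/or3P=> us; [move: l2|move: t2|move: r2] => /hasPn/(_ u us)/negP[].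
  have [l0 t0 r0] : [/\ l = [::], t = [::] & r = [::]].
    move: rest0; case: (l) => [|u l1]; last by move/(_ u); rewrite mem_head => /(_ isT).
    case: (t) => [|u t1]; last by move/(_ u); rewrite mem_head => /(_ isT).
    by case: (r) => [|u r1] //; move/(_ u); rewrite mem_head => /(_ isT).
  move: spl1 spl2; rewrite /s l0 t0 r0 /= !cats0 => spl1 spl2.
  exact: kappa_remove2.
have pos1 : [seq u.1 | u <- remove_block kappa U1 s] =
            [seq u.1 | u <- (l ++ t) ++ c ++ r].
  by rewrite (remove_blockE spl1) absorb_fst -catA.
have pos2 : [seq u.1 | u <- remove_block kappa U2 s] =
            [seq u.1 | u <- l ++ b ++ t ++ r].
  by rewrite sE2 (remove_blockE spl2) absorb_fst -!catA.
have spl2' : splits U2 (l ++ t) c r.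
  case/and4P: spl2 => cU cn0 H rU; apply/and4P; split=> //.
  by move: H; rewrite !has_cat !negb_or => /and3P[-> _ ->].
have spl1' : splits U1 l b (t ++ r).
  case/and4P: spl1 => bU bn0 lU H; apply/and4P; split=> //.
  by move: H; rewrite !has_cat !negb_or => /and3P[-> _ ->].
have cardD U : U \in P -> #|(P :\ U)%SET| = j.+2.
  by move=> PU; move: cardP; rewrite (cardsD1 U) PU => -[].
have -> : nested_product kappa j.+1 (P :\ U1)%SET (remove_block kappa U1 s) =
    nested_product kappa j (P :\ U1 :\ U2)%SET
      (remove_block kappa U2 (remove_block kappa U1 s)).
  apply: IH => //; [exact: cardD | | exact: splits_interval spl2' pos1].
  rewrite pos1 -catA; exact: partitions_remove spl1 P1 valP.
have -> : nested_product kappa j.+1 (P :\ U2)%SET (remove_block kappa U2 s) =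
    nested_product kappa j (P :\ U2 :\ U1)%SET
      (remove_block kappa U1 (remove_block kappa U2 s)).
  apply: IH => //; [exact: cardD | | | exact: splits_interval spl1' pos2].
    rewrite pos2; have := partitions_remove spl2 P2; rewrite -!catA; apply; exact: valP.
  by rewrite !inE U12.
rewrite DC (remove_blocksC D12 spl1 spl2) //.
have /card_gt0P[U] : (0 < #|(P :\ U1 :\ U2)%SET|)%N by rewrite card12.
rewrite !inE => /and3P[UU2 UU1 PU].
have [_ meetP _] := valP; have := meetP _ PU; rewrite has_map /s !has_cat.
have nb : ~~ has (in_block U) b.
  case/and4P: spl1 => bU _ _ _; apply: hasN_disjoint bU _.
  by apply: partitions_disjoint valP P1 PU _; rewrite eq_sym.
have nc : ~~ has (in_block U) c.
  case/and4P: spl2 => bU _ _ _; apply: hasN_disjoint bU _.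
  by apply: partitions_disjoint valP P2 PU _; rewrite eq_sym.
rewrite [has _ b](negbTE nb) [has _ c](negbTE nc) /= => H.
apply/eqP => H0; move: H; rewrite -!has_cat H0; by [].
Qed.

Lemma nested_productE (m : nat) : removable m.
Proof.
suff step j : (forall j', j = j'.+1 -> removable j') -> removable j.
  by elim: m => [|m IHm]; apply: step => // _ [<-].
move=> IH {m} P V s cardP valP PV Vint.
rewrite /=; case: pickP => [W /andP[PW Wint]|/(_ V)]; last by rewrite PV Vint.
have [->//|WV] := eqVneq W V.
have [tiP meetP covP] := valP.
have hasS U : U \in P -> has (in_block U) s by move/meetP; rewrite has_map.
have [l [b [r [sE splW]]]] := interval_splits Wint (hasS _ PW).
have [l' [c [r' [sE' splV]]]] := interval_splits Vint (hasS _ PV).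
have VW : V != W by rewrite eq_sym.
have [le_l|/ltnW le_l] := leqP (size l) (size l').
  have [] := two_splits (partitions_disjoint valP PW PV WV) splW splV _ le_l.
    by rewrite -sE -sE'.
  move=> t [def_l' def_r]; subst l' r; clear sE'; subst s; exact: nested_product_swap.
have [] := two_splits (partitions_disjoint valP PV PW VW) splV splW _ le_l.
  by rewrite -sE -sE'.
move=> t [def_l def_r']; subst l r'; symmetry; clear sE; subst s; exact: nested_product_swap.
Qed.

End Confluence.

(** * Sums over noncrossing partitions *)

Section StackPartitions.
Variable n : nat.
Implicit Types (V W : {set 'I_n}) (P Q : {set {set 'I_n}}) (pl pr : seq 'I_n).

Definition ltI (i j : 'I_n) : bool := (i < j)%N.

Definition noncross P : bool :=
  [forall V in P, forall W in P, (V != W) ==>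
    [forall i in V, forall j in W, forall k in V, forall l in W,
      ~~ [&& i < j, j < k & k < l]%N]].

Lemma noncrossP P :
  reflect (forall V W i j k l, V \in P -> W \in P -> V != W ->
             i \in V -> j \in W -> k \in V -> l \in W ->
             (i < j)%N -> (j < k)%N -> (k < l)%N -> False)
          (noncross P).
Proof.
apply: (iffP idP) => [nc V W i j k l PV PW VW iV jW kV lW ij jk kl|nc].
  move: nc => /forall_inP/(_ V PV)/forall_inP/(_ W PW)/implyP/(_ VW).
  move=> /forall_inP/(_ i iV)/forall_inP/(_ j jW)/forall_inP/(_ k kV).
  by move=> /forall_inP/(_ l lW); rewrite ij jk kl.
apply/forall_inP => V PV; apply/forall_inP => W PW; apply/implyP => VW.
apply/forall_inP => i iV; apply/forall_inP => j jW.
apply/forall_inP => k kV; apply/forall_inP => l lW.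
by apply/negP => /and3P[ij jk kl]; exact: (nc V W i j k l).
Qed.

(* pl is the stack: the blocks that end there have already been removed. *)
Definition open_on pl pr P : bool :=
  [&& finset.partition P [set i in pl ++ pr]%SET, noncross P &
    [forall V in P, ~~ (V \subset pl)]].

(** Positions are listed in increasing order, bottom of the stack first, whereas [shift_reduce]
    keeps its stack top first. *)
Definition top_block pl i q : {set 'I_n} :=
  [set j in drop (size pl - q) (rcons pl i)]%SET.

Lemma sorted_ltI_uniq p : sorted ltI p -> uniq p.
Proof. by apply: sorted_uniq => [i j k|i]; [exact: ltn_trans|exact: ltnn]. Qed.

Lemma card_top_block pl i q : uniq (rcons pl i) -> (q <= size pl)%N ->
  #|top_block pl i q| = q.+1.
Proof.
move=> Up le_q; rewrite /top_block cardsE; move/card_uniqP: (drop_uniq (size pl - q) Up) => ->.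
by rewrite size_drop size_rcons subSn ?leq_subr // subKn.
Qed.

Lemma mem_top_block pl i q : i \in top_block pl i q.
Proof.
by rewrite inE drop_rcons ?leq_subr // mem_rcons mem_head.
Qed.

(** Not being inside the stack, the block contains [i]. If it skipped a stack position [k] above one
    of its own positions [j], the block of [k], which must leave the stack, would have an element
    [w] after [i], and [j < k < i < w] would be a crossing. *)
Lemma closed_block pl i pr P V : sorted ltI (pl ++ i :: pr) ->
  open_on pl (i :: pr) P -> V \in P -> V \subset rcons pl i ->
  exists2 q, (q <= size pl)%N & V = top_block pl i q.
Proof.
move=> Sp /and3P[partP /noncrossP nc /forall_inP op] PV Vsub.
have iV : i \in V.
  have /fintype.subsetPn[j jV jpl] := op _ PV.
  by have := fintype.subsetP Vsub _ jV; rewrite mem_rcons inE (negbTE jpl) orbF => /eqP <-.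
have Sp1 : sorted ltI (rcons pl i).
  by move: Sp; rewrite -cat_rcons => /cat_sorted2[].
have lt_i k : k \in pl -> (k < i)%N.
  move=> kpl; move: Sp; rewrite sorted_pairwise; last by move=> ? ? ?; exact: ltn_trans.
  rewrite pairwise_cat => /and3P[/allrelP/(_ k i kpl)] H _ _; apply: H.
  by rewrite mem_head.
have gt_i w : w \in pr -> (i < w)%N.
  move: Sp => /cat_sorted2[_ /=]; rewrite path_sortedE; last by move=> ? ? ?; exact: ltn_trans.
  by case/andP=> /allP H _ /H.
have up j k : j \in V -> k \in rcons pl i -> (j < k)%N -> k \in V.
  move=> jV kpl jk; apply/negPn/negP => kV.
  have ki : k != i by apply: contraNneq kV => ->.
  have k_pl : k \in pl by move: kpl; rewrite mem_rcons inE (negbTE ki).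
  have : k \in finset.cover P.
    by rewrite (finset.cover_partition partP) inE mem_cat k_pl.
  case/finset.bigcupP=> W PW kW; have /fintype.subsetPn[w wW wpl] := op _ PW.
  have VW : V != W by apply: contraNneq kV => ->.
  have : w \in finset.cover P by apply/finset.bigcupP; exists W.
  rewrite (finset.cover_partition partP) inE mem_cat (negbTE wpl) /= inE => /orP[/eqP wi|wpr].
    have := finset.partition_trivIset partP => /finset.trivIsetP/(_ V W PV PW VW).
    by move/disjointFr/(_ iV); rewrite -wi wW.
  exact: (nc V W j k i w PV PW VW jV kW iV wW jk (lt_i _ k_pl) (gt_i _ wpr)).
pose h := find (mem V) (rcons pl i).
have hasV : has (mem V) (rcons pl i) by apply/hasP; exists i; rewrite ?mem_rcons ?mem_head.
have lt_h : (h < size (rcons pl i))%N by rewrite -has_find.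
exists (size pl - h)%N; first exact: leq_subr.
have le_h : (h <= size pl)%N by rewrite size_rcons in lt_h.
rewrite /top_block subKn //; apply/setP => j; rewrite inE.
apply/idP/idP => [jV|].
  have := fintype.subsetP Vsub _ jV; rewrite -{1}(cat_take_drop h (rcons pl i)) mem_cat.
  case/orP=> // jt; have := has_take h hasV; rewrite -/h ltnn.
  by move=> /negbT/hasPn/(_ j jt)/negP[].
rewrite (drop_nth i) // inE; have hV : nth i (rcons pl i) h \in V by apply: (nth_find i hasV).
case/orP=> [/eqP-> //|jd]; apply: (up _ _ hV).
  by rewrite -(cat_take_drop h.+1 (rcons pl i)) mem_cat jd orbT.
move: Sp1; rewrite -{1}(cat_take_drop h (rcons pl i)) (drop_nth i) //.
case/cat_sorted2=> _ /=; rewrite path_sortedE; last by move=> ? ? ?; exact: ltn_trans.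
by case/andP=> /allP/(_ j jd).
Qed.

Lemma open_on_top pl i pr q Q : sorted ltI (pl ++ i :: pr) -> (q <= size pl)%N ->
  open_on pl (i :: pr) (top_block pl i q |: Q)%SET &&
     ((top_block pl i q |: Q) :\ top_block pl i q == Q)%SET =
  open_on (take (size pl - q) pl) pr Q.
Proof.
move=> Sp le_q; set V := top_block pl i q; set l := take _ pl.
have Up := sorted_ltI_uniq Sp.
have plE : rcons pl i = l ++ drop (size pl - q) (rcons pl i).
  rewrite -{1}(cat_take_drop (size pl - q) (rcons pl i)) -cats1 takel_cat //.
  exact: leq_subr.
have plE2 : pl ++ i :: pr = l ++ drop (size pl - q) (rcons pl i) ++ pr.
  by rewrite -cat_rcons {1}plE catA.
have VE j : (j \in V) = (j \in drop (size pl - q) (rcons pl i)) by rewrite inE.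
have Dl : [set j in pl ++ i :: pr]%SET = (V :|: [set j in l ++ pr])%SET.
  apply/setP => j; rewrite !inE plE2 !mem_cat; case: (j \in l) => /=; by rewrite ?orbT.
have dis : fintype.disjoint (mem V) (mem [set j in l ++ pr]%SET).
  apply/pred0P => j /=; rewrite VE inE; apply/negP => /andP[jd].
  move: Up; rewrite plE2 cat_uniq mem_cat has_cat negb_or => /and3P[_ /andP[/hasPn H _]].
  rewrite cat_uniq => /and3P[_ /hasPn H' _] /orP[jl|jp].
    by move: (H _ jd); rewrite jl.
  by move: (H' _ jp); rewrite jd.
have V0 : V != finset.set0.
  by apply/set0Pn; exists i; apply: mem_top_block.
have lpl : {subset l <= pl} by move=> j; apply: mem_take.
have Vsub : {subset V <= rcons pl i} by move=> j; rewrite VE; apply: mem_drop.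
have betw (a b c : 'I_n) : a \in V -> c \in V -> (a < b)%N -> (b < c)%N ->
    b \in l ++ pr -> False.
  rewrite !VE mem_cat => aV cV ab bc; have := Sp.
  rewrite plE2 sorted_pairwise; last by move=> ? ? ?; exact: ltn_trans.
  rewrite pairwise_cat allrel_catr => /and3P[/andP[/allrelP H1 _] _].
  rewrite pairwise_cat => /and3P[/allrelP H2 _ _] /orP[bl|bp].
    by have := ltn_trans (H1 _ _ bl aV) ab; rewrite ltnn.
  by have := ltn_trans (H2 _ _ cV bp) bc; rewrite ltnn.
apply/andP/idP => [[/and3P[partP /noncrossP nc /forall_inP op] /eqP QE]|].
  have VP : V \in (V |: Q)%SET by rewrite !inE eqxx.
  have partQ : finset.partition Q [set j in l ++ pr]%SET.
    have := finset.partitionD1 partP VP; rewrite QE Dl finset.setDUl finset.setDv finset.set0U.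
    by move: dis; rewrite disjoint_sym => /finset.setDidPl->.
  have QV W : W \in Q -> W \in (V |: Q)%SET by move=> QW; rewrite !inE QW orbT.
  apply/and3P; split=> //.
    apply/noncrossP => V1 V2 a b c d P1 P2.
    exact: nc (QV _ P1) (QV _ P2).
  apply/forall_inP => W QW; apply: contra (op _ (QV _ QW)) => Wl.
  by apply: (fintype.subset_trans Wl); apply/fintype.subsetP.
case/and3P=> partQ /noncrossP nc /forall_inP op.
have covQ W j : W \in Q -> j \in W -> j \in l ++ pr.
  move=> QW jW; have : j \in finset.cover Q by apply/finset.bigcupP; exists W.
  by rewrite (finset.cover_partition partQ) inE.
have VQ : V \notin Q.
  apply/negP => QV; have /set0Pn[j jV] := V0.
  by move/pred0P: dis => /(_ j) /=; rewrite jV inE (covQ V).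
split; last by rewrite finset.setU1K.
apply/and3P; split.
- by rewrite Dl; apply: finset.partitionU1.
- apply/noncrossP => V1 V2 a b c d; rewrite !inE.
  case/predU1P=> [->|Q1] /predU1P[->|Q2]; rewrite ?eqxx //.
  + move=> _ aV bV2 cV _ ab bc _; exact: (betw a b c aV cV ab bc (covQ _ _ Q2 bV2)).
  + move=> _ _ bV cV1 dV _ bc cd; exact: (betw b c d bV dV bc cd (covQ _ _ Q1 cV1)).
  exact: nc.
apply/forall_inP => W; rewrite !inE => /predU1P[->|QW].
  apply/fintype.subsetPn; exists i; first exact: mem_top_block.
  by move: Up; rewrite cat_uniq => /and3P[_ /norP[]].
apply: contra (op _ QW) => /fintype.subsetP Wpl; apply/fintype.subsetP => j jW.
have := covQ _ _ QW jW; rewrite mem_cat => /orP[//|jpr].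
move: Up; rewrite -cat_rcons cat_uniq => /and3P[_ /hasPn/(_ _ jpr) /negP[]].
by rewrite mem_rcons inE (Wpl _ jW) orbT.
Qed.

(** The recursion of [shift_reduce] seen on partitions: [i] joins the stack, or its block ends at
    [i]. *)
Lemma big_open_on (A : nmodType) (F : {set {set 'I_n}} -> A) pl i pr :
  sorted ltI (pl ++ i :: pr) ->
  \sum_(P | open_on pl (i :: pr) P) F P =
  \sum_(P | open_on (rcons pl i) pr P) F P +
  \sum_(0 <= q < (size pl).+1)
    \sum_(Q | open_on (take (size pl - q) pl) pr Q) F (top_block pl i q |: Q)%SET.
Proof.
move=> Sp; rewrite (bigID (fun P => [forall V in P, ~~ (V \subset rcons pl i)])) /=.
have Up : uniq (rcons pl i).
  by have := sorted_ltI_uniq Sp; rewrite -cat_rcons cat_uniq => /and3P[].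
congr (_ + _).
  apply: eq_bigl => P; rewrite /open_on cat_rcons.
  case: finset.partition => //=; case: noncross => //=.
  apply/andP/idP => [[] //|op]; split=> //; apply/forall_inP => V PV.
  apply: contra (forall_inP op V PV) => /fintype.subset_trans; apply.
  by apply/fintype.subsetP => j; rewrite mem_rcons inE => ->; rewrite orbT.
rewrite big_mkord.
(* A closed block is determined by the number of stack letters it takes, its cardinal minus one. *)
rewrite (partition_big (fun P => inord #|finset.pblock P i|.-1 : 'I_(size pl).+1) predT) //=.
apply: eq_bigr => q _; have le_q : (q <= size pl)%N by rewrite -ltnS.
rewrite (reindex_onto (fun Q => top_block pl i q |: Q)%SET
                      (fun P => P :\ top_block pl i q)%SET) /=.
  apply: eq_bigl => Q; rewrite -(open_on_top _ Sp) //.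
  case opP: (open_on _ _ _) => //=.
  have PV : top_block pl i q \in (top_block pl i q |: Q)%SET by rewrite !inE eqxx.
  have -> : [forall V in (top_block pl i q |: Q)%SET, ~~ (V \subset rcons pl i)] = false.
    apply/negbTE/forall_inPn; exists (top_block pl i q) => //; rewrite negbK.
    apply/fintype.subsetP => j; rewrite inE; exact: mem_drop.
  have -> : finset.pblock (top_block pl i q |: Q)%SET i = top_block pl i q.
    case/and3P: opP => /finset.partition_trivIset tiP _ _.
    by apply: finset.def_pblock => //; exact: mem_top_block.
  rewrite card_top_block //=; suff -> : inord q = q by rewrite eqxx.
  exact: inord_val.
move=> P /andP[/andP[opP /forall_inPn[V PV]]]; rewrite negbK => Vsub /eqP def_q.
have [r le_r def_V] := closed_block Sp opP PV Vsub.
suff -> : top_block pl i q = V by rewrite finset.setD1K.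
rewrite def_V; congr top_block; rewrite -def_q.
have -> : finset.pblock P i = V.
  case/and3P: opP => /finset.partition_trivIset tiP _ _.
  by apply: finset.def_pblock => //; rewrite def_V mem_top_block.
by rewrite def_V card_top_block // inordK.
Qed.

End StackPartitions.

Section MomentShiftReduce.
Variables (R : realType) (A : algType R[i]) (D : set A) (kappa : seq A -> A).
Hypothesis bm : bimodule_maps D kappa.

Lemma shift_reduce_bottom (l : seq A) v y u : D v ->
  shift_reduce kappa (@empty_stack _ A) (rcons l (v * y)) u =
  v * shift_reduce kappa (@empty_stack _ A) (rcons l y) u.
Proof.
move=> Dv; elim: u l y => [|x u IHu] l y /=.
  by rewrite /empty_stack /nilp !size_rcons mulr0.
rewrite -!rcons_cons !IHu mulrDr; congr (_ + _).
rewrite !size_rcons mulr_sumr; apply: eq_big_nat => q /andP[_ le_q].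
have [le_ql|lt_lq] := leqP q (size l).
  rewrite !drop_rcons // -!cats1 !takel_cat //.
  case: (drop q l) => [|z l'] /=; first by rewrite -mulrA (IHu [::]).
  by rewrite !cats1 -!rcons_cons IHu.
rewrite !drop_oversize ?take_oversize ?size_rcons //=.
by rewrite -!rcons_cons !rev_rcons (bm_left bm) // mulrA.
Qed.

(** Reconciles two conventions for the value of a leftmost block: [absorb] multiplies it into the
    next letter, [push_value] moves it in front of everything. *)
Lemma shift_reduce_left v y u : D v ->
  shift_reduce kappa (@empty_stack _ A) [::] (v * y :: u) =
  v * shift_reduce kappa (@empty_stack _ A) [::] (y :: u).
Proof.
move=> Dv; rewrite /= !big_nat1 /= !(shift_reduce_bottom [::]) // mulrDr.
by rewrite (bm_left bm) // mulrA.
Qed.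

Variable n : nat.
Implicit Types (s l r : seq ('I_n * A)) (P Q : {set {set 'I_n}}).
Local Notation pos s := [seq u.1 | u <- s].
Local Notation vals s := [seq u.2 | u <- s].

Lemma open_on_nil_r (pl : seq 'I_n) P : pl != [::] -> ~~ open_on pl [::] P.
Proof.
case: pl => [//|i pl] _; apply/negP => /and3P[partP _ /forall_inP op].
have : i \in finset.cover P.
  by rewrite (finset.cover_partition partP) inE cats0 mem_head.
case/finset.bigcupP=> V PV iV; case/negP: (op _ PV).
apply/fintype.subsetP => j jV; have : j \in finset.cover P.
  by apply/finset.bigcupP; exists V.
by rewrite (finset.cover_partition partP) inE cats0.
Qed.

Lemma open_on_nil P : open_on (Nil 'I_n) [::] P = (P == finset.set0).
Proof.
rewrite /open_on; have -> : [set i in Nil 'I_n ++ [::]]%SET = finset.set0.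
  by apply/setP => i; rewrite !inE.
rewrite finset.partition_set0; case: eqP => //= ->.
apply/andP; split; last by apply/forall_inP => V; rewrite inE.
by apply/noncrossP => V W i j k l0; rewrite inE.
Qed.

Lemma open_on_partitions (pl pr : seq 'I_n) P : open_on pl pr P -> partitions P (pl ++ pr).
Proof.
case/and3P=> partP _ _; split; first exact: finset.partition_trivIset partP.
- move=> V PV; have /set0Pn[i iV] := finset.partition_neq0 partP PV.
  apply/hasP; exists i => //; have : i \in finset.cover P.
    by apply/finset.bigcupP; exists V.
  by rewrite (finset.cover_partition partP) inE.
move=> i ip; have : i \in finset.cover P.
  by rewrite (finset.cover_partition partP) inE.
by case/finset.bigcupP=> V PV iV; exists V.
Qed.

Lemma sum_open_on_nil l : l != [::] ->
  \sum_(P | open_on (pos l) [::] P) nested_product kappa #|P|.-1 P (l ++ [::]) =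
  shift_reduce kappa (@empty_stack _ A) (rev (vals l)) [::].
Proof.
move=> l_n0; rewrite big_pred0 => [|P]; last first.
  by apply/negbTE/open_on_nil_r; rewrite -size_eq0 size_map size_eq0.
by rewrite /= /empty_stack /nilp size_rev size_map size_eq0 (negbTE l_n0).
Qed.

Lemma top_block_splits l i x r q : (q <= size l)%N ->
  uniq (pos (l ++ (i, x) :: r)) ->
  splits (top_block (pos l) i q) (take (size l - q) l)
    (drop (size l - q) (rcons l (i, x))) r.
Proof.
move=> le_q; set b := drop _ _; set k := (size l - q)%N.
have VE u : in_block (top_block (pos l) i q) u = (u.1 \in pos b).
  by rewrite /in_block inE size_map -/k -(map_rcons fst l (i, x)) -map_drop.
have -> : l ++ (i, x) :: r = take k l ++ b ++ r.
  rewrite catA -cat_rcons -{1}(cat_take_drop k (rcons l (i, x))) -cats1.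
  by rewrite takel_cat ?leq_subr // cats1.
rewrite !map_cat cat_uniq has_cat negb_or => /and3P[_ /andP[/hasPn lb _]].
rewrite cat_uniq => /and3P[_ /hasPn br _].
apply/and4P; split.
- by apply/allP => u ub; rewrite VE; apply: map_f.
- by rewrite -size_eq0 size_drop size_rcons subSn ?leq_subr.
- apply/hasPn => u ul; rewrite VE; apply/negP => /lb /negP[]; exact: map_f.
by apply/hasPn => u ur; rewrite VE; apply: br; apply: map_f.
Qed.

Lemma sum_open_on l r : sorted (@ltI n) (pos (l ++ r)) -> l ++ r != [::] ->
  \sum_(P | open_on (pos l) (pos r) P) nested_product kappa #|P|.-1 P (l ++ r) =
  shift_reduce kappa (@empty_stack _ A) (rev (vals l)) (vals r).
Proof.
move: {2}(size r) (leqnn (size r)) => m; elim: m l r => [|m IHm] l [|[i x] r] // le_r.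
- by move=> _ ln0; rewrite cats0 in ln0; exact: sum_open_on_nil.
- by move=> _ ln0; rewrite cats0 in ln0; exact: sum_open_on_nil.
move=> Sp _; have Sp' := Sp; rewrite map_cat in Sp'.
have Up := sorted_ltI_uniq Sp.
rewrite [pos (_ :: _)]/= (big_open_on _ Sp') /=; congr (_ + _).
  rewrite -rev_rcons -(map_rcons snd l (i, x)) -(map_rcons fst l (i, x)) -cat_rcons.
  apply: IHm => //; first by rewrite cat_rcons.
  by rewrite -size_eq0 size_cat size_rcons.
rewrite size_rev !size_map; apply: eq_big_nat => q /andP[_ le_q].
have le_q' : (q <= size l)%N by [].
set V := top_block _ _ _; set k := (size l - q)%N.
have splV := top_block_splits le_q' Up.
rewrite -/V -/k in splV; set b := drop _ _ in splV; set l' := take _ _ in splV.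
have sE : l ++ (i, x) :: r = l' ++ b ++ r.
  rewrite catA -cat_rcons -{1}(cat_take_drop k (rcons l (i, x))) -cats1.
  by rewrite takel_cat ?leq_subr // cats1.
have -> : rev (x :: take q (rev (vals l))) = vals b.
  rewrite take_rev rev_cons revK size_map -/k -map_drop /b drop_rcons ?leq_subr //.
  by rewrite map_rcons.
have -> : drop q (rev (vals l)) = rev (vals l').
  by rewrite drop_rev size_map -/k -map_take.
rewrite -map_take -/l'.
have VP Q : V \in (V |: Q)%SET by rewrite !inE eqxx.
(* If nothing survives, the block is everything that was left and only the empty partition
   remains. *)
have [rest0|rest_n0] := eqVneq (l' ++ r) [::].
  move: sE splV rest0; case: (l') (r) => [|//] [|//] sE splV _.
  rewrite (big_pred1 finset.set0) => [|Q]; last exact: open_on_nil.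
  by rewrite finset.setU0 cards1 /= sE cats0 mulr1.
have openD Q : open_on (pos l') (pos r) Q ->
    nested_product kappa #|(V |: Q)%SET|.-1 (V |: Q)%SET (l ++ (i, x) :: r) =
    nested_product kappa #|Q|.-1 Q (absorb l' (kappa (vals b)) r).
  move=> opQ; have := open_on_top (q := q) Q Sp'; rewrite size_map -/k -map_take -/l' -/V.
  rewrite opQ => /(_ le_q') /andP[opVQ /eqP VQE].
  have [j cardQ] : exists j, #|Q| = j.+1.
    case cardQ: #|Q| => [|j]; last by exists j.
    have [_ _ covQ] := open_on_partitions opQ.
    case def_u: (l' ++ r) rest_n0 => [//|u t] _; have [|W QW _] := covQ u.1.
      by rewrite -map_cat def_u mem_head.
    by move/eqP: cardQ; rewrite cards_eq0 => /eqP Q0; move: QW; rewrite Q0 inE.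
  have VQ : V \notin Q by rewrite -VQE finset.setD11.
  have cardVQ : #|(V |: Q)%SET| = j.+2 by rewrite cardsU1 VQ cardQ.
  rewrite cardVQ cardQ /= -[LHS]/(nested_product kappa j.+1 _ _).
  have valVQ : partitions (V |: Q)%SET (pos (l ++ (i, x) :: r)).
    by rewrite map_cat; exact: open_on_partitions.
  rewrite (nested_productE bm cardVQ valVQ (VP Q)) ?VQE; last first.
    by rewrite sE; apply: splits_interval splV _.
  by rewrite sE (remove_blockE _ splV).
rewrite (eq_bigr _ openD).
have Sp2 : sorted (@ltI n) (pos (l' ++ r)).
  apply: (subseq_sorted _ _ Sp); first by move=> ? ? ?; exact: ltn_trans.
  apply: map_subseq; rewrite sE; apply: cat_subseq; [exact: subseq_refl|exact: suffix_subseq].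
have Dv : D (kappa (vals b)).
  apply: (bm_codomain bm); case/and4P: splV => _ bn0 _ _.
  by rewrite -size_eq0 size_map size_eq0.
set v := kappa (vals b) in Dv *.
clear openD sE splV.
case/lastP: l' rest_n0 Sp2 => [|l' [j y]] rest_n0 Sp2.
  case: r le_r rest_n0 Sp2 {Sp Sp' Up} => [//|[j y] r] le_r _ Sp2 /=.
  have := IHm [::] ((j, v * y) :: r) le_r Sp2 isT; rewrite [pos _]/= [pos _]/= => ->.
  exact: shift_reduce_left.
rewrite !map_rcons rev_rcons /=.
have := IHm (rcons l' (j, y * v)) r le_r.
rewrite !map_rcons rev_rcons => <-.
- by apply: eq_bigr => Q _; rewrite absorb_rcons cat_rcons.
- by move: Sp2; rewrite !map_cat !map_rcons.
by rewrite -size_eq0 size_cat size_rcons.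
Qed.

Lemma sum_NC_shift_reduce (a : n.-tuple A) : (0 < n)%N ->
  \sum_(P in NC n) kappa_part kappa P a = moment kappa a.
Proof.
move=> n_gt0; set s := [seq (i, tnth a i) | i <- enum 'I_n].
have pos_s : pos s = enum 'I_n by rewrite -map_comp map_id.
have vals_s : vals s = a by rewrite -map_comp map_tnth_enum.
have Ss : sorted (@ltI n) (pos s).
  rewrite pos_s; have := iota_ltn_sorted 0 n; rewrite -val_enum_ord.
  by rewrite sorted_map.
have sn0 : s != [::] by rewrite -size_eq0 size_map size_enum_ord -lt0n.
have := @sum_open_on [::] s Ss sn0; rewrite /= vals_s /moment => <-.
apply: eq_bigl => P; rewrite inE /noncrossing /open_on /= pos_s.
have -> : [set i in enum 'I_n]%SET = [set: 'I_n]%SET.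
  by apply/setP => i; rewrite !inE mem_enum.
case partP: (finset.partition _ _) => //=; rewrite -/(noncross P).
rewrite [X in _ && X](_ : _ = true) ?andbT //.
apply/forall_inP => V PV; have /set0Pn[i iV] := finset.partition_neq0 partP PV.
by apply/fintype.subsetPn; exists i.
Qed.

End MomentShiftReduce.

(** * Centered moments and scalar cumulants *)

Section CenteredMoments.
Variables (K : comNzRingType) (A : algType K) (D : set A) (E : A -> A).
Variable kappa : seq A -> A.
Hypothesis EB : forall x y, E (x - y) = E x - E y.
Hypothesis E_left : forall d x, D d -> E (d * x) = d * E x.
Hypothesis ED : forall x, D (E x).
Hypothesis kappa_right : forall s x d, D d ->
  kappa (rcons s (x * d)) = kappa (rcons s x) * d.
Hypothesis momentE : forall u, moment kappa u = E (\prod_(x <- u) x).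

(** Once read, the last letter [x] either tops the stack and receives [d], or ends a block whose
    value takes [d] inside by [kappa_right]. *)
Lemma shift_reduce_push_last k d l p x : D d ->
  shift_reduce kappa (push_value k ^~ d) l (rcons p x) =
    shift_reduce kappa k l (rcons p (x * d)).
Proof.
move=> Dd; elim: p l => [|y p IHp] l /=.
  congr (_ + _); apply: eq_bigr => q _; rewrite !rev_cons kappa_right //.
  by case: (drop q l) => [|z l'] /=; rewrite mulrA.
rewrite IHp; congr (_ + _); apply: eq_bigr => q _.
by case: (drop q l) => [|z l'] /=; rewrite IHp.
Qed.

(** For genuine cumulants the formal subtraction is the actual one, because pushing the expectation
    of [w] multiplies it into the letter before [w]. The prefix [pre] collects the words taken
    uncentered, as the induction requires. *)
Lemma centered_reduce_moment ws pre :
  shift_reduce kappa (centered_reduce kappa ws) [::] pre =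
  E (\prod_(x <- pre) x *
     \prod_(w <- ws) (\prod_(x <- w) x - E (\prod_(x <- w) x))).
Proof.
elim: ws pre => [|w ws IHws] pre.
  by rewrite [centered_reduce _ _]/= -/(moment kappa pre) momentE big_nil mulr1.
rewrite big_cons; set Z := \prod_(w0 <- ws) _ in IHws *.
rewrite [centered_reduce _ _]/= shift_reduceB -shift_reduce_cat IHws big_cat /= momentE.
set W := \prod_(x <- w) x; rewrite mulrBl mulrBr EB mulrA; congr (_ - _).
case/lastP: pre => [|p x] /=.
  have := IHws [::]; rewrite /= big_nil mul1r => ->.
  by rewrite mul1r E_left.
by rewrite shift_reduce_push_last // IHws -!cats1 !big_cat !big_seq1 /= !mulrA.
Qed.

End CenteredMoments.

(** * Two families of maps that agree below a given length *)

Section Difference.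
Variables (K : comNzRingType) (A : algType K) (kappa1 kappa2 : seq A -> A).
Variable N : nat.
Hypothesis eq_kappa : forall t, t != [::] -> (size t < N)%N -> kappa1 t = kappa2 t.
Implicit Types (k l u : seq A).
Local Notation dkappa t := (kappa1 t - kappa2 t).

Lemma eq_kappa_top x l q : (size l + 1 < N)%N ->
  kappa1 (rev (x :: take q l)) = kappa2 (rev (x :: take q l)).
Proof.
move=> lt_lN; apply: eq_kappa; rewrite -?size_eq0 size_rev //=.
by apply: leq_ltn_trans lt_lN; rewrite addn1 ltnS size_take_min geq_minr.
Qed.

Lemma eq_shift_reduce_lt (k1 k2 : seq A -> A) j l u : (j <= N)%N ->
  (forall l', (size l' < j)%N -> k1 l' = k2 l') -> (size l + size u < j)%N ->
  shift_reduce kappa1 k1 l u = shift_reduce kappa2 k2 l u.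
Proof.
move=> le_jN eqk; elim: u l => [|x u IHu] l /= lt_j; first by apply: eqk; lia.
rewrite IHu /=; last by lia.
congr (_ + _); apply: eq_bigr => q _; rewrite eq_kappa_top; last by lia.
have := size_drop q l; case: (drop q l) => [|z l'] /= sz; rewrite IHu //=; lia.
Qed.

Lemma eq_moment_lt u : (size u < N)%N -> moment kappa1 u = moment kappa2 u.
Proof. by move=> lt_uN; apply: (@eq_shift_reduce_lt _ _ N). Qed.

Lemma shift_reduce_diff (k1 k2 err : seq A -> A) j l u : (j < N)%N ->
  (forall l', (size l' < j)%N -> k1 l' = k2 l') ->
  (forall l', size l' = j -> k1 l' = k2 l' + err l') ->
  (size l + size u)%N = j ->
  shift_reduce kappa1 k1 l u = shift_reduce kappa2 k2 l u + err (catrev u l).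
Proof.
move=> lt_jN eqk errk; elim: u l => [|x u IHu] l /= sz_j; first by apply: errk; lia.
rewrite IHu /=; last by lia.
rewrite addrAC; congr (_ + _ + _); apply: eq_bigr => q _.
rewrite eq_kappa_top; last by lia.
have := size_drop q l; case: (drop q l) => [|z l'] /= sz;
  rewrite (@eq_shift_reduce_lt k1 k2 j) //=; lia.
Qed.

Lemma shift_reduce_diff_top l u : u != [::] -> (size l + size u)%N = N ->
  shift_reduce kappa1 (@empty_stack _ A) l u =
  shift_reduce kappa2 (@empty_stack _ A) l u + dkappa (rev l ++ u).
Proof.
elim: u l => [//|x u IHu] l _ /= sz_N.
(* The omitted term [q = size l] closes everything read so far; it alone can use a block of length
   [N], namely when [u] is empty. *)
have sumE : \sum_(0 <= q < size l)
      push_value (fun l' => shift_reduce kappa1 (@empty_stack _ A) l' u) (drop q l)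
        (kappa1 (rev (x :: take q l))) =
    \sum_(0 <= q < size l)
      push_value (fun l' => shift_reduce kappa2 (@empty_stack _ A) l' u) (drop q l)
        (kappa2 (rev (x :: take q l))).
  apply: eq_big_nat => q /andP[_ lt_q]; rewrite (eq_kappa (t := rev _)); last 2 first.
  - by rewrite -size_eq0 size_rev.
  - by rewrite size_rev /= size_takel ?(ltnW lt_q) //; lia.
  have := size_drop q l; case: (drop q l) => [|z l'] /= sz; first by lia.
  case: (u) sz_N => [//|y u'] sz_N; apply: (@eq_shift_reduce_lt _ _ N) => //.
  by move: sz sz_N => /=; lia.
rewrite !big_nat_recr //= sumE drop_size take_size /=.
have [u0|u_n0] := eqVneq u [::].
  rewrite u0 /empty_stack /= !mulr1 cats1 -rev_cons !add0r -addrA; congr (_ + _).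
  by rewrite addrC subrK.
rewrite IHu //; last by rewrite /=; lia.
rewrite (eq_kappa (t := rev _)); last 2 first.
- by rewrite -size_eq0 size_rev.
- by rewrite size_rev /=; case: (u) u_n0 sz_N => [//|y u'] _ /=; lia.
rewrite (@eq_shift_reduce_lt _ (@empty_stack _ A) N [::] u) //=; last by lia.
by rewrite rev_cons cat_rcons addrAC.
Qed.

Lemma eq_centered_reduce_lt ws l : (size l + size (flatten ws) < N)%N ->
  centered_reduce kappa1 ws l = centered_reduce kappa2 ws l.
Proof.
elim: ws l => [//|w ws IHws] l /=; rewrite size_cat => sz_N.
rewrite (@eq_shift_reduce_lt _ (centered_reduce kappa2 ws) (N - size (flatten ws))) //;
  first last.
- by lia.
- by move=> l' lt_l'; apply: IHws; lia.
- exact: leq_subr.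
congr (_ - _); rewrite eq_moment_lt; last by lia.
by case: l sz_N => [|y l'] /= sz_N; rewrite IHws //=; lia.
Qed.

(** Only the block of all letters has length [N], and the centering terms involve shorter blocks. A
    single word on the empty stack is excluded, since there the subtracted moment contains the same
    block and the difference cancels. *)
Lemma centered_reduce_diff ws l : all (fun w => w != [::]) ws ->
  (l != [::]) || (1 < size ws)%N ->
  ws != [::] -> (size l + size (flatten ws))%N = N ->
  centered_reduce kappa1 ws l = centered_reduce kappa2 ws l + dkappa (rev l ++ flatten ws).
Proof.
elim: ws l => [//|w ws IHws] l /= /andP[w_n0 ws_n0] l_n0 _.
rewrite size_cat => sz_N.
have w_gt0 : (0 < size w)%N by rewrite lt0n size_eq0.
have [ws0|ws_n0'] := eqVneq ws [::].
  move: l_n0 sz_N; rewrite ws0 orbF /= addn0 cats0; case: l => [//|y l] _ sz_N.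
  by rewrite shift_reduce_diff_top // addrAC.
have fl_gt0 : (0 < size (flatten ws))%N.
  by case: (ws) ws_n0 ws_n0' => [//|[|x w'] ws'].
rewrite (@shift_reduce_diff _ (centered_reduce kappa2 ws) (fun l' => dkappa (rev l' ++
  flatten ws))
          (size l + size w)) //; first last.
- move=> l' sz_l'; apply: (IHws l' ws_n0 _ ws_n0'); last by rewrite sz_l' -addnA.
  by rewrite -size_eq0 sz_l' -lt0n addn_gt0 w_gt0 orbT.
- by move=> l' lt_l'; apply: eq_centered_reduce_lt; rewrite -sz_N addnA ltn_add2r.
- by rewrite -sz_N addnA -[ltnLHS]addn0 ltn_add2l.
rewrite catrevE rev_cat revK -catA addrAC; congr (_ - _ + _).
rewrite eq_moment_lt; last first.
  by rewrite -sz_N addnCA -[ltnLHS]addn0 ltn_add2l addn_gt0 fl_gt0 orbT.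
have eq_src l' : (size l' <= size l)%N -> centered_reduce kappa1 ws l' =
  centered_reduce kappa2 ws l'.
  move=> le_l'; apply: eq_centered_reduce_lt; rewrite -sz_N addnA ltn_add2r.
  by apply: leq_ltn_trans le_l' _; rewrite -[ltnLHS]addn0 ltn_add2l.
by case: l eq_src {sz_N l_n0} => [|y l'] eq_src /=; rewrite eq_src.
Qed.

End Difference.

(** * Existence of the scalar cumulants *)

Section ScalarCumulants.
Variables (R : realType) (A : algType R[i]) (phi : {scalar A}).
Hypothesis phi1 : phi 1 = 1.
Local Notation E := (scalar_expectation phi).
Local Notation S := (@scalars R A).

(** Solves the moment-cumulant relation length by length. The family with bound [n'] vanishes on
    longer lists, so on a list of length [n'.+1] its [moment] sums over all partitions except the
    one-block partition; what is missing from the expectation is the new cumulant. *)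
Fixpoint truncated_cumulant n (s : seq A) : A :=
  if n is n'.+1 then
    if size s == n then E (\prod_(x <- s) x) - moment (truncated_cumulant n') s
    else truncated_cumulant n' s
  else 0.

Definition scalar_cumulant s := truncated_cumulant (size s) s.

Lemma truncated_cumulant_gt n s : (n < size s)%N -> truncated_cumulant n s = 0.
Proof.
elim: n => [//|n IHn] /= lt_n; rewrite ifN ?IHn ?neq_ltn ?lt_n ?orbT //.
exact: ltnW.
Qed.

Lemma truncated_cumulant_le n s :
  (size s <= n)%N -> truncated_cumulant n s = scalar_cumulant s.
Proof.
elim: n => [|n IHn] /=; first by rewrite leqn0 /scalar_cumulant => /eqP->.
rewrite leq_eqVlt; case: eqP => [sz_s _|_ /= lt_s]; last exact: IHn.
by rewrite /scalar_cumulant sz_s /= sz_s eqxx.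
Qed.

Lemma scalarsD x y : S x -> S y -> S (x + y).
Proof. by move=> [c _ <-] [d _ <-]; exists (c + d); rewrite // scalerDl. Qed.

Lemma scalarsZ c x : S x -> S (c *: x).
Proof. by move=> [d _ <-]; exists (c * d); rewrite // scalerA. Qed.

Lemma scalarsM x y : S x -> S y -> S (x * y).
Proof.
by move=> [c _ <-] Sy; rewrite -scalerAl mul1r; apply: scalarsZ.
Qed.

Lemma scalars0 : S 0. Proof. by exists 0; rewrite // scale0r. Qed.
Lemma scalars1 : S 1. Proof. by exists 1; rewrite // scale1r. Qed.

Lemma scalarsB x y : S x -> S y -> S (x - y).
Proof. by move=> Sx Sy; rewrite -scaleN1r; apply/scalarsD/scalarsZ. Qed.

Lemma scalarsE x : S (E x). Proof. by exists (phi x). Qed.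

Lemma scalar_expectation_linear c x y : E (c *: x + y) = c *: E x + E y.
Proof. by rewrite /scalar_expectation linearP scalerDl scalerA. Qed.

Lemma scalar_expectation1 : E 1 = 1.
Proof. by rewrite /scalar_expectation phi1 scale1r. Qed.

Lemma scalar_expectation_left d x : S d -> E (d * x) = d * E x.
Proof.
case=> c _ <-; rewrite -!scalerAl !mul1r.
by rewrite /scalar_expectation linearZ scalerA.
Qed.

Lemma shift_reduce_scalars kappa l u : (forall s, S (kappa s)) ->
  S (shift_reduce kappa (@empty_stack _ A) l u).
Proof.
move=> kS; elim: u l => [|x u IHu] l /=.
  by rewrite /empty_stack; case: nilp; [apply: scalars1|apply: scalars0].
apply: scalarsD => //; elim/big_ind: _ => [||q _]; first exact: scalars0.
  exact: scalarsD.
by case: (drop q l) => [|z l'] //=; apply: scalarsM.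
Qed.

Lemma truncated_cumulant_scalars n s : S (truncated_cumulant n s).
Proof.
elim: n s => [|n IHn] s /=; first exact: scalars0.
case: ifP => // _; apply: scalarsB; first exact: scalarsE.
exact: shift_reduce_scalars.
Qed.

Lemma prod_multilinear : multilinear (fun s : seq A => \prod_(x <- s) x).
Proof.
by move=> s t c x y; rewrite /= !big_cat /= !big_cons mulrDl mulrDr -scalerAl -scalerAr.
Qed.

Lemma truncated_cumulant_multilinear n : multilinear (truncated_cumulant n).
Proof.
elim: n => [|n IHn] s t c x y /=; first by rewrite scaler0 addr0.
rewrite !size_cat /= prod_multilinear (moment_multilinear IHn) IHn.
by case: ifP => // _; rewrite scalar_expectation_linear scalerBr addrACA opprD.
Qed.

Lemma scalar_cumulant_multilinear : multilinear scalar_cumulant.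
Proof.
move=> s t c x y; rewrite /scalar_cumulant !size_cat /=.
exact: truncated_cumulant_multilinear.
Qed.

Lemma scalar_cumulant_scalars s : S (scalar_cumulant s).
Proof. exact: truncated_cumulant_scalars. Qed.

Lemma scalar_cumulant_diff n t : t != [::] -> (size t < n.+1)%N ->
  scalar_cumulant t = truncated_cumulant n t.
Proof. by move=> _ le_tn; rewrite truncated_cumulant_le. Qed.

Lemma moment_scalar_cumulant u : moment scalar_cumulant u = E (\prod_(x <- u) x).
Proof.
case sz_u: (size u) => [|n].
  by rewrite (size0nil sz_u) big_nil scalar_expectation1.
have u_n0 : u != [::] by rewrite -size_eq0 sz_u.
rewrite /moment (shift_reduce_diff_top (@scalar_cumulant_diff n) u_n0) //=.
by rewrite truncated_cumulant_gt ?sz_u // subr0 /scalar_cumulant sz_u /= sz_u eqxx addrC subrK.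
Qed.

Lemma scalar_cumulant_right s x d : S d ->
  scalar_cumulant (rcons s (x * d)) = scalar_cumulant (rcons s x) * d.
Proof.
case=> c _ <-; rewrite -!scalerAr !mulr1 -!cats1.
exact: multilinearZ scalar_cumulant_multilinear.
Qed.

Lemma scalar_cumulantsP : cumulants S E scalar_cumulant.
Proof.
have kL := scalar_cumulant_multilinear.
have bm : bimodule_maps S scalar_cumulant.
  split=> //.
  - by move=> s _; apply: scalar_cumulant_scalars.
  - move=> s t x d y [c _ <-]; rewrite -scalerAr mulr1 -scalerAl mul1r.
    rewrite (multilinearZ _ _ _ _ kL).
    by have := multilinearZ (rcons s x) t c y kL; rewrite !cat_rcons => ->.
  - move=> d x s [c _ <-]; rewrite -!scalerAl !mul1r.
    exact: (multilinearZ [::]).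
  exact: scalar_cumulant_right.
split=> // n a n_gt0; rewrite (sum_NC_shift_reduce bm) // moment_scalar_cumulant.
by rewrite big_tuple.
Qed.

End ScalarCumulants.

Lemma alternatingE e : alternating e <-> ~~ odd (size e) && sorted neqb e.
Proof.
have altE b k : flatten (nseq k [:: b; ~~ b]) = altseq b k.*2.
  by elim: k => [//|k IHk]; rewrite doubleS !altseqS negbK /= IHk.
split=> [[k [b ->]]|/andP[ev_e sE]].
  by rewrite altE size_altseq odd_double altseq_sorted.
exists (size e)./2, (head true e); rewrite altE.
rewrite [in RHS]even_halfK //; apply: sorted_altseq => //; by case: (e).
Qed.

(** Cut between any two equal neighbours; a word that is not alternating has at least one cut. *)
Lemma segments e : e != [::] -> exists es,
  [/\ flatten es = e, chained None es & ~~ sorted neqb e -> (1 < size es)%N].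
Proof.
elim: e => [//|b [|c e] IHe] _; first by exists [:: [:: b]].
have [//|[|[|c' f] es] [def_e ch sz]] := IHe.
- by [].
- by [].
move: def_e ch => [def_c def_e] /= /andP[p_f ch]; subst c'.
have [eq_bc|neq_bc] := eqVneq b c.
  exists ([:: b] :: (c :: f) :: es); split=> //=; first by rewrite def_e.
  by rewrite p_f ch eq_bc eqxx.
exists ((b :: c :: f) :: es); split=> /=; first by rewrite def_e.
  by rewrite /neqb neq_bc p_f.
by rewrite /neqb neq_bc /= => /sz.
Qed.

Lemma chained_neq0 es : chained None es -> all (fun e => e != [::]) es.
Proof.
move: None => o; elim: es o => [//|[//|b e] es IHes] o /= /and3P[_ _].
exact: IHes.
Qed.

Lemma chained_sorted o es e : chained o es -> e \in es -> sorted neqb e.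
Proof.
elim: es o => [//|[//|b f] es IHes] o /= /and3P[p_f _ ch].
by rewrite inE => /predU1P[->|]; [|apply: IHes ch].
Qed.

Section Letters.
Variables (R : realType) (A : algType R[i]) (star : A -> A) (a : A).

(** Coefficients stand on both sides because a closed block multiplies the letter before it from the
    right. *)
Definition letters (D : set A) (b : bool) : set A :=
  [set x | exists d d', [/\ D d, D d' & x = d * star_pow star a b * d']].

Definition word (e : seq bool) : A := \prod_(b <- e) star_pow star a b.

Section Valued.
Variables (F : set A) (E : {linear A -> A}).
Hypothesis vps : valued_probability_space star F E.
Hypothesis Rdiag : R_diagonal F E star a.

Lemma vps_mul x y : F x -> F y -> F (x * y).
Proof. by case: (vps_subalgebra vps) => -[_ _ FM] _ Fx Fy; apply/set_mem/FM;
  exact/mem_set. Qed.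

Lemma vps_1 : F 1.
Proof. by case: (vps_subalgebra vps) => -[F1 _ _] _; apply/set_mem. Qed.

Lemma vps_left d x : F d -> E (d * x) = d * E x.
Proof. by move=> Fd; have := vps_bimodule vps x Fd vps_1; rewrite !mulr1. Qed.

Lemma vps_right d x : F d -> E (x * d) = E x * d.
Proof. by move=> Fd; have := vps_bimodule vps x vps_1 Fd; rewrite !mul1r. Qed.

Lemma letters_right b x d : letters F b x -> F d -> letters F b (x * d).
Proof.
move=> [d1 [d2 [F1 F2 ->]]] Fd; exists d1, (d2 * d).
by split=> //; [exact: vps_mul | rewrite mulrA].
Qed.

Lemma R_diagonal_letters : exists2 kappa, bimodule_maps F kappa &
  (forall u, moment kappa u = E (\prod_(x <- u) x)) /\
  (forall e s, typed (letters F) e s -> s != [::] ->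
     ~~ (~~ odd (size e) && sorted neqb e) -> kappa s = 0).
Proof.
have [kappa [bm mc] k0] := Rdiag; exists kappa => //; split=> [u|].
  have [->|u_n0] := eqVneq u [::]; first by rewrite big_nil (vps_unit vps).
  have u_gt0 : (0 < size u)%N by rewrite lt0n size_eq0.
  have := mc _ (in_tuple u) u_gt0; rewrite (sum_NC_shift_reduce bm) // => <-.
  by rewrite -(big_tuple _ _ (in_tuple u) predT id).
(* [pre] lists the letters whose right coefficient is already gone: it moves into the next letter by
   balancedness, and the last one leaves [kappa] on the right. *)
have claim (e : seq bool) s (pre : seq (A * bool)) : typed (letters F) e s ->
    (forall u, u \in pre -> F u.1) -> (pre != [::]) || (s != [::]) ->
    ~ alternating ([seq u.2 | u <- pre] ++ e) ->
    kappa ([seq u.1 * star_pow star a u.2 | u <- pre] ++ s) = 0.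
  elim: e s pre => [|b e IHe] [|x s] pre //=.
    rewrite !cats0 orbF => _ Fpre pre0 nalt; exact: k0.
  case=> -[d [d' [Fd Fd' ->]]] es Fpre _ nalt.
  have Fpre' u : u \in rcons pre (d, b) -> F u.1.
    by rewrite mem_rcons inE => /predU1P[->|/Fpre].
  case: s e es nalt IHe => [|y s] [|c e] // es nalt IHe.
    rewrite cats1 (bm_right bm) //.
    have := IHe [::] (rcons pre (d, b)); rewrite !map_rcons !cats0 => -> //.
    - by rewrite mul0r.
    - by rewrite -size_eq0 size_rcons.
    by rewrite -cats1.
  case: es => -[d1 [d2 [F1 F2 def_y]]] es.
  rewrite (bm_balanced bm) //.
  have := IHe (d' * y :: s) (rcons pre (d, b)); rewrite !map_rcons !cat_rcons;
    apply=> //; last by rewrite orbT.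
  split=> //; exists (d' * d1), d2; split=> //; first exact: vps_mul.
  by rewrite def_y !mulrA.
move=> e s es s_n0 nalt; apply: (claim e s [::]) => //.
by move/alternatingE; apply/negP.
Qed.

Lemma expectation_odd e w : typed (letters F) e w -> odd (size w) ->
  E (\prod_(x <- w) x) = 0.
Proof.
have [kappa bm [momE k0]] := R_diagonal_letters => ew odd_w; rewrite -momE.
apply: (moment_odd letters_right (bm_codomain bm) (bm_linear bm) k0 ew odd_w).
Qed.

Lemma expectation_chained es ws : typed_words (letters F) es ws ->
  chained None es -> es != [::] ->
  E (\prod_(w <- ws) (\prod_(x <- w) x - E (\prod_(x <- w) x))) = 0.
Proof.
have [kappa bm [momE k0]] := R_diagonal_letters => ew ch es0.
have EB x y : E (x - y) = E x - E y by rewrite linearB.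
have := centered_reduce_moment EB vps_left (vps_codomain vps)
  (fun s x d (Fd : F d) => bm_right bm s x Fd) momE ws [::].
rewrite big_nil mul1r => <-.
apply: (centered_reduce_chained letters_right (bm_codomain bm) (bm_linear bm) k0 (el :=
  [::]) ew) => //.
by rewrite es0.
Qed.

End Valued.

Section Scalar.
Variable phi : {scalar A}.
Hypothesis phi1 : phi 1 = 1.
Hypothesis phi_odd : forall e, sorted neqb e -> odd (size e) -> phi (word e) = 0.
Hypothesis phi_chained : forall es, es != [::] -> chained None es ->
  phi (\prod_(e <- es) (word e - (phi (word e))%:A)) = 0.

Definition multiples (b : bool) : set A :=
  [set x | exists c : R[i], x = c *: star_pow star a b].

Lemma typed_multiples f e s : multilinear f -> typed multiples e s ->
  exists c, f s = c *: f [seq star_pow star a b | b <- e].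
Proof.
move=> fL; suff claim pre : typed multiples e s ->
    exists c, f (pre ++ s) = c *: f (pre ++ [seq star_pow star a b | b <- e]).
  exact: (claim [::]).
elim: e s pre => [|b e IHe] [|x s] pre //=.
  by exists 1; rewrite scale1r.
case=> -[c ->] /(IHe _ (rcons pre (star_pow star a b))) [c']; rewrite !cat_rcons => E'.
by exists (c * c'); rewrite (multilinearZ _ _ _ _ fL) E' scalerA.
Qed.

(* By induction the cumulants truncated below the size n of the word w satisfy
   R-diagonality, so their centered moments vanish; those of the true cumulants
   vanish by assumption, and the difference is the cumulant of w. *)
Lemma scalar_cumulant_letters e : e != [::] ->
  ~~ (~~ odd (size e) && sorted neqb e) ->
  scalar_cumulant phi [seq star_pow star a b | b <- e] = 0.
Proof.
move: {2}(size e).+1 (ltnSn (size e)) => N; elim: N e => [//|N IHN] e le_eN e_n0 nalt.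
set w := [seq _ | b <- e].
have w_n0 : w != [::] by rewrite -size_eq0 size_map size_eq0.
case sz_e: (size e) => [|n]; first by rewrite (size0nil sz_e) in e_n0.
have sz_w : size w = n.+1 by rewrite size_map.
set kappa2 := truncated_cumulant phi n.
have k2L : multilinear kappa2 by exact: truncated_cumulant_multilinear.
have k2S s : s != [::] -> scalars (kappa2 s).
  by move=> _; exact: truncated_cumulant_scalars.
have k2w : kappa2 w = 0 by rewrite /kappa2 truncated_cumulant_gt ?sz_w.
have mulS b x d : multiples b x -> @scalars R A d -> multiples b (x * d).
  by move=> [c ->] [c' _ <-]; exists (c' * c); rewrite -scalerAr mulr1 scalerA.
have k20 e' s : typed multiples e' s -> s != [::] ->
    ~~ (~~ odd (size e') && sorted neqb e') -> kappa2 s = 0.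
  move=> Ts s_n0 nalt'; have [lt_ns|le_sn] := ltnP n (size s).
    by rewrite /kappa2 truncated_cumulant_gt.
  rewrite /kappa2 truncated_cumulant_le //.
  have [c ->] := typed_multiples (scalar_cumulant_multilinear phi) Ts.
  rewrite IHN ?scaler0 //; first by rewrite (typed_size Ts); lia.
  by rewrite -size_eq0 (typed_size Ts) size_eq0.
have typed_word e' : typed multiples e' [seq star_pow star a b | b <- e'].
  by elim: e' => //= b e' IHe'; split=> //; exists 1; rewrite scale1r.
have diff := @scalar_cumulant_diff R A phi n.
have prodE e' : \prod_(x <- [seq star_pow star a b | b <- e']) x = word e'.
  by rewrite big_map.
have EB x y : scalar_expectation phi (x - y) =
    scalar_expectation phi x - scalar_expectation phi y.
  by rewrite /scalar_expectation linearB scalerBl.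
(* An alternating word cannot be cut, so [centered_reduce_diff] does not apply; its length is odd
   here, and uncentered moments are compared instead. *)
have [sE|nsE] := boolP (sorted neqb e).
  have odd_e : odd (size e) by move: nalt; rewrite sE andbT negbK.
  have := moment_scalar_cumulant phi1 w; rewrite prodE /scalar_expectation phi_odd // scale0r.
  rewrite /moment (shift_reduce_diff_top diff (l := [::]) w_n0 sz_w) -/kappa2 [rev _ ++
    _]/= k2w subr0.
  rewrite -/(moment _ w) (moment_odd mulS k2S k2L k20 (typed_word e)) ?add0r //.
  by rewrite size_map.
have [es [def_e ch /(_ nsE) sz_es]] := segments e_n0.
pose ws := [seq [seq star_pow star a b | b <- e'] | e' <- es].
have Tws : typed_words multiples es ws.
  by rewrite /ws; elim: (es) => //= e' es' IHes; split.
have flat_ws : flatten ws = w by rewrite /w -def_e map_flatten.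
have es_n0 : es != [::] by case: (es) sz_es.
have ws_n0 : ws != [::] by rewrite -size_eq0 size_map size_eq0.
have := centered_reduce_moment EB (scalar_expectation_left phi) (scalarsE phi)
  (scalar_cumulant_right phi) (moment_scalar_cumulant phi1) ws [::].
rewrite big_nil mul1r big_map.
have -> : \prod_(e' <- es) (\prod_(x <- [seq star_pow star a b | b <- e']) x
      - scalar_expectation phi (\prod_(x <- [seq star_pow star a b | b <- e']) x)) =
    \prod_(e' <- es) (word e' - (phi (word e'))%:A).
  by apply: eq_bigr => e' _; rewrite prodE.
rewrite [RHS]/scalar_expectation phi_chained // scale0r /=.
rewrite (centered_reduce_diff diff (l := [::])) ?flat_ws //=; last 2 first.
- rewrite all_map; apply: sub_all (chained_neq0 ch) => e' /=.
  by rewrite -!size_eq0 size_map.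
- by rewrite size_map.
rewrite -/kappa2 k2w subr0 (centered_reduce_chained mulS k2S k2L k20 (el := [::]) Tws)
  ?es_n0 ?add0r //.
Qed.

Lemma scalar_R_diagonal_moments : scalar_R_diagonal phi star a.
Proof.
exists (scalar_cumulant phi); first exact: scalar_cumulantsP.
move=> w w_n0 Dw nalt; set e := [seq u.2 | u <- w] in nalt *.
have Tw : typed multiples e [seq u.1 * star_pow star a u.2 | u <- w].
  rewrite /e; elim: w Dw {w_n0 nalt e} => //= u w IHw Dw; split.
    have [|c _ <-] := Dw u; first exact: mem_head.
    by exists c; rewrite -scalerAl mul1r.
  by apply: IHw => v vw; apply: Dw; rewrite inE vw orbT.
have [c ->] := typed_multiples (scalar_cumulant_multilinear phi) Tw.
rewrite scalar_cumulant_letters ?scaler0 //.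
  by rewrite -size_eq0 size_map size_eq0.
by apply/negP => /alternatingE.
Qed.

End Scalar.
End Letters.

(** * Spans of alternating words *)

Section Subalgebra.
Variables (R : realType) (A : algType R[i]).

Lemma unital_subalgebraP (B : set A) : unital_subalgebra B <->
  [/\ B 1, forall (c : R[i]) x y, B x -> B y -> B (c *: x + y)
    & forall x y, B x -> B y -> B (x * y)].
Proof.
split=> [[B1 BL BM]|[B1 BL BM]]; split.
- exact/set_mem.
- by move=> c x y Bx By; apply/set_mem/BL; exact/mem_set.
- by move=> x y Bx By; apply/set_mem/BM; exact/mem_set.
- exact/mem_set.
- by move=> c x y /set_mem Bx /set_mem By; apply/mem_set/BL.
- by move=> x y /set_mem Bx /set_mem By; apply/mem_set/BM.
Qed.

Lemma generated_algebra_sub (X B : set A) x :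
  unital_subalgebra B -> (forall y, X y -> B y) -> generated_algebra X x -> B x.
Proof. by move=> Balg XB; apply; split. Qed.

Lemma sub_generated_algebra (X : set A) x : X x -> generated_algebra X x.
Proof. by move=> Xx B [_ XB]; apply: XB. Qed.

Lemma generated_algebra_subalgebra (X : set A) :
  unital_subalgebra (generated_algebra X).
Proof.
apply/unital_subalgebraP; split.
- by move=> B [/unital_subalgebraP[B1 _ _] _].
- move=> c x y gx gy B BX; have [/unital_subalgebraP[_ BL _] _] := BX.
  by apply: BL; [apply: gx|apply: gy].
move=> x y gx gy B BX; have [/unital_subalgebraP[_ _ BM] _] := BX.
by apply: BM; [apply: gx|apply: gy].
Qed.

End Subalgebra.

Section WordSpan.
Variables (R : realType) (A : algType R[i]) (star : A -> A) (a : A).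
Variables (F : set A) (E : {linear A -> A}).
Hypothesis vps : valued_probability_space star F E.
Hypothesis Rdiag : R_diagonal F E star a.
Local Notation L := (letters star a F).

Lemma vps_lin c x y : F x -> F y -> F (c *: x + y).
Proof.
by case: (vps_subalgebra vps) => /unital_subalgebraP[_ FL _] _; exact: FL.
Qed.

Lemma vps_scalar c : F c%:A.
Proof.
have F1 := vps_1 vps; have F0 : F 0 by rewrite -(subrr 1) addrC -scaleN1r; exact: vps_lin.
by rewrite -[_%:A]addr0; apply: vps_lin.
Qed.

Lemma vps_id d : F d -> E d = d.
Proof. by move=> Fd; rewrite -[d in LHS]mul1r (vps_right vps) // (vps_unit vps) mul1r. Qed.

(* Alternating words from the letter b to the letter c, false standing for a and
   true for a*; F itself belongs to both types of words of even length. *)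
Inductive word_span : bool -> bool -> A -> Prop :=
| word_span_base b d : F d -> word_span b (~~ b) d
| word_span_word b e w : typed L (b :: e) w -> path neqb b e ->
    word_span b (last b e) (\prod_(x <- w) x)
| word_span_add b c x y : word_span b c x -> word_span b c y -> word_span b c (x + y).

Lemma word_span_left b c d x : F d -> word_span b c x -> word_span b c (d * x).
Proof.
move=> Fd; elim=> {b c x} [b d' Fd'|b e w Tw p_e|b c x y _ IHx _ IHy].
- by apply: word_span_base; apply: (vps_mul vps).
- case: w Tw => [//|x w] [[d1 [d2 [F1 F2 ->]]] Tw].
  rewrite big_cons !mulrA -[d * d1 * _ * _]/(d * d1 * star_pow star a b * d2).
  have -> : d * d1 * star_pow star a b * d2 * \prod_(y <- w) y =
      \prod_(y <- (d * d1 * star_pow star a b * d2) :: w) y by rewrite big_cons.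
  apply: word_span_word => //; split=> //; exists (d * d1), d2.
  by split=> //; apply: (vps_mul vps).
by rewrite mulrDr; apply: word_span_add.
Qed.

Lemma word_span_right b c d x : F d -> word_span b c x -> word_span b c (x * d).
Proof.
move=> Fd; elim=> {b c x} [b d' Fd'|b e w Tw p_e|b c x y _ IHx _ IHy].
- by apply: word_span_base; apply: (vps_mul vps).
- have [w' Tw' <-] : exists2 w', typed L (b :: e) w' &
      \prod_(x <- w') x = (\prod_(x <- w) x) * d.
    elim: e b w Tw {p_e} => [|c e IHe] b [|x w] //= [Lx Tw].
      case: w Tw => // _; exists [:: x * d]; last by rewrite !big_seq1.
      by split=> //; apply: (letters_right vps).
    have [w' Tw' E'] := IHe c w Tw; exists (x :: w') => //.
    by rewrite !big_cons E' mulrA.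
  exact: word_span_word.
by rewrite mulrDl; apply: word_span_add.
Qed.

Lemma word_span_mul b c c' e x y : c' = ~~ c -> word_span b c x -> word_span c' e y ->
  word_span b e (x * y).
Proof.
move=> def_c' Sx; elim: Sx c' def_c' => {b c x}
    [b d Fd|b e1 w Tw p_e|b c x1 x2 _ IH1 _ IH2] c' def_c' Sy.
- by move: Sy; rewrite def_c' negbK; apply: word_span_left.
- elim: Sy def_c' => {c' e y}
      [c' d Fd|c' e2 w' Tw' p_e'|c' e x1 x2 _ IH1 _ IH2] def_c'.
  + by rewrite def_c' negbK; apply: word_span_right => //; apply: word_span_word.
  + rewrite -big_cat; have -> : last c' e2 = last b (e1 ++ c' :: e2).
      by rewrite last_cat.
    apply: word_span_word; first by rewrite -cat_cons; apply: typed_cat.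
    by rewrite cat_path p_e /= p_e' def_c' /neqb; case: (last b e1).
  by rewrite mulrDr; apply: word_span_add; [apply: IH1|apply: IH2].
by rewrite mulrDl; apply: word_span_add; [apply: (IH1 c')|apply: (IH2 c')].
Qed.

Lemma word_spanZ b c (k : R[i]) x : word_span b c x -> word_span b c (k *: x).
Proof.
move=> Sx; rewrite -[x]mul1r scalerAl; apply: word_span_left => //.
exact: vps_scalar.
Qed.

Lemma word_span_odd b x : word_span b b x -> E x = 0.
Proof.
move: {1 3}b (erefl b) => c + Sx; elim: Sx => {b c x}
  [b d _|b e w Tw p_e|b c x y _ IHx _ IHy] def_c.
- by case: b def_c.
- apply: (expectation_odd vps Rdiag Tw); rewrite -(typed_size Tw) /=.
  have := @last_sorted b e p_e; rewrite -def_c.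
  by case: b {Tw p_e def_c} (odd _) => [] [].
by rewrite linearD IHx ?IHy ?addr0.
Qed.

Lemma word_span_letter b : word_span b b (star_pow star a b).
Proof.
rewrite -[star_pow _ _ _](big_seq1 *%R _ id); apply: (@word_span_word b [::]) => //=.
split=> //; exists 1, 1; rewrite mulr1 mul1r; split=> //; exact: (vps_1 vps).
Qed.

(** Elements of [F] get no constructor of their own: centering turns them into 0. *)
Inductive centered_span : bool -> bool -> A -> Prop :=
| centered_span0 b c : centered_span b c 0
| centered_span_word b e w : typed L (b :: e) w -> path neqb b e ->
    centered_span b (last b e) (\prod_(x <- w) x - E (\prod_(x <- w) x))
| centered_span_add b c x y : centered_span b c x -> centered_span b c y ->
    centered_span b c (x + y).

Lemma word_span_centered b c x : word_span b c x -> centered_span b c (x - E x).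
Proof.
elim=> {b c x} [b d Fd|b e w Tw p_e|b c x y _ IHx _ IHy].
- by rewrite vps_id // subrr; apply: centered_span0.
- exact: centered_span_word.
by rewrite linearD opprD addrACA; apply: centered_span_add.
Qed.

(* An item ((b, c), y) is an element y with first letter b and last letter c. *)
Definition linked (s t : bool * bool * A) : bool := s.1.2 == t.1.1.

Lemma expectation_linked (ts : seq (bool * bool * A)) :
  (forall t, t \in ts -> centered_span t.1.1 t.1.2 t.2) ->
  sorted linked ts -> ts != [::] -> E (\prod_(t <- ts) t.2) = 0.
Proof.
pose Z ws := \prod_(w <- ws) (\prod_(x <- w) x - E (\prod_(x <- w) x)).
(* Items are expanded into words from left to right. The condition on [es] says, in continuation
   form, that whatever may follow the letter [o] may follow [es]. *)
have claim o es ws : typed_words L es ws ->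
    (forall es', chained o es' -> chained None (es ++ es')) ->
    (forall t, t \in ts -> centered_span t.1.1 t.1.2 t.2) ->
    sorted linked ts -> oapp (fun c => head c [seq t.1.1 | t <- ts] == c) true o ->
    (es != [::]) || (ts != [::]) -> E (Z ws * \prod_(t <- ts) t.2) = 0.
  elim: ts o es ws => [|[[b c] y] ts IHts] o es ws Tws ch Cts link_ts o_ts n0.
    rewrite big_nil mulr1 (expectation_chained vps Rdiag Tws) //.
      by have := ch [::] isT; rewrite cats0.
    by move: n0; rewrite orbF.
  rewrite big_cons mulrA.
  have Cts' t : t \in ts -> centered_span t.1.1 t.1.2 t.2.
    by move=> ts_t; apply: Cts; rewrite inE ts_t orbT.
  have link_ts' := path_sorted link_ts.
  have next_c : head c [seq t.1.1 | t <- ts] == c.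
    by case: (ts) link_ts => [//|t ts'] /= /andP[/eqP <- _].
  have := Cts _ (mem_head _ _); rewrite /= in o_ts *.
  move=> Cy; elim: Cy o_ts next_c => {b c y link_ts Cts n0}
      [b c|b e w Tw p_e|b c x1 x2 _ IH1 _ IH2] o_ts next_c.
  - by rewrite mulr0 mul0r linear0.
  - have -> : Z ws * (\prod_(x <- w) x - E (\prod_(x <- w) x)) = Z (rcons ws w).
      by rewrite /Z -cats1 big_cat big_seq1.
    apply: (IHts (Some (last b e)) (rcons es (b :: e))) => //.
    + by elim: es ws Tws {ch} => [|e1 es IHes] [|w1 ws] //= [Tw1 /IHes].
    + move=> es' ch'; rewrite cat_rcons; apply: ch => /=; rewrite p_e ch' andbT /=.
      by case: (o) o_ts => //= c0.
    by rewrite -size_eq0 size_rcons.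
  by rewrite mulrDr mulrDl linearD IH1 ?IH2 ?addr0.
move=> Cts link_ts ts_n0; have := claim None [::] [::] I (fun _ => id) Cts link_ts isT.
by rewrite /Z big_nil mul1r; apply.
Qed.

End WordSpan.

(** * Scalar words *)

Section ScalarWords.
Variables (R : realType) (A : algType R[i]) (star : A -> A).
Variables (F : set A) (E : {linear A -> A}) (phi : {scalar A}) (a : A).
Hypothesis vps : valued_probability_space star F E.
Hypothesis sps : scalar_probability_space star phi.
Hypothesis phiE : forall x, phi x = phi (E x).
Hypothesis Rdiag : R_diagonal F E star a.
Hypothesis free_aF : free_pair phi [set a * star a] F.

Let P : set A := generated_algebra ([set a * star a] `|` @scalars R A).

Let aa_subalgebra : unital_subalgebra P.
Proof. exact: generated_algebra_subalgebra. Qed.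

Lemma aa1 : P 1. Proof. by have /unital_subalgebraP[] := aa_subalgebra. Qed.

Lemma aa_lin c x y : P x -> P y -> P (c *: x + y).
Proof. by have /unital_subalgebraP[_ PL _] := aa_subalgebra; apply: PL. Qed.

Lemma aa_mul x y : P x -> P y -> P (x * y).
Proof. by have /unital_subalgebraP[_ _ PM] := aa_subalgebra; apply: PM. Qed.

Lemma aa_gen : P (a * star a).
Proof. by apply: sub_generated_algebra; left. Qed.

Lemma phi_scalar c : phi c%:A = c.
Proof. by rewrite linearZ (sps_unit sps) /= mulr1. Qed.

Lemma phi_centered x : phi (x - (phi x)%:A) = 0.
Proof. by rewrite linearB /= phi_scalar subrr. Qed.

Lemma aa_centered x : P x -> P (x - (phi x)%:A).
Proof.
move=> Px; rewrite addrC -scaleNr; apply: aa_lin => //; exact: aa1.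
Qed.

Lemma F_centered x : F x -> F (x - (phi x)%:A).
Proof.
move=> Fx; rewrite addrC -scaleNr; apply: (vps_lin vps) => //.
exact: (vps_1 vps).
Qed.

(* The tag true marks elements of P, the tag false elements of F. *)
Definition alternates (w : seq (bool * A)) : Prop :=
  (forall u, u \in w -> (if u.1 then P u.2 else F u.2) /\ phi u.2 = 0) /\
  sorted (fun u v : bool * A => u.1 != v.1) w.

Lemma alternates_phi w : alternates w -> w != [::] -> phi (\prod_(u <- w) u.2) = 0.
Proof.
case=> Cw Sw w_n0; have := free_aF w_n0 _ Sw.
rewrite /scalar_expectation => H; rewrite -[LHS]phi_scalar H ?linear0 //.
move=> u /Cw[Xu phi_u]; rewrite phi_u scale0r; split=> //.
by case: u.1 Xu => // Fu; apply: sub_generated_algebra; left.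
Qed.

(* core l r: products p0 f1 p1 ... fk pk with p_i in P and f_i in F, all
   phi-centered except that p0 (if l) and pk (if r) are arbitrary. *)
Inductive core : bool -> bool -> A -> Prop :=
| core_base l r p : P p -> is_true (l || r) \/ phi p = 0 -> core l r p
| core_cons l r p f x : P p -> is_true l \/ phi p = 0 -> F f -> phi f = 0 ->
    core false r x -> core l r (p * f * x).

Lemma alternates_insert w p f q w2 :
  alternates (w ++ (true, p) :: w2) -> alternates (w ++ (true, q) :: w2) ->
  F f -> phi f = 0 ->
  alternates ((w ++ [:: (true, p); (false, f)]) ++ (true, q) :: w2).
Proof.
move=> [Cp Sp] [Cq Sq] Ff cf; split=> [u|].
  rewrite -catA /= mem_cat !inE => /or4P[uw|/eqP->|/eqP->|] //.
  - by apply: Cp; rewrite mem_cat uw.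
  - by apply: (Cp (true, p)); rewrite mem_cat mem_head orbT.
  by move=> uq; apply: Cq; rewrite mem_cat inE uq orbT.
move: Sp Sq; rewrite -catA /=; case: w {Cp Cq} => [|v w] /=.
  by case: w2.
by rewrite !cat_path /= => /and3P[-> -> _] /and3P[_ _ ->].
Qed.

Lemma alternates_prefix w1 w2 : alternates (w1 ++ w2) -> alternates w1.
Proof.
case=> Cw Sw; split; first by move=> u uw; apply: Cw; rewrite mem_cat uw.
by case/cat_sorted2: Sw.
Qed.

Lemma aa0 : P 0.
Proof. by rewrite -(addNr 1) -scaleN1r; apply: aa_lin; exact: aa1. Qed.

(** Written out, this is an alternating product of centered factors, so freeness applies. An
    arbitrary right end is split into a centered part and a scalar; the scalar leaves a prefix that
    is still nonempty and alternating. *)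
Lemma phi_core_context l r x : core l r x -> l = false -> forall w w2,
  (forall q, P q -> phi q = 0 -> alternates (w ++ (true, q) :: w2)) ->
  (r -> w != [::] /\ w2 = [::]) ->
  phi ((\prod_(u <- w) u.2) * x * \prod_(u <- w2) u.2) = 0.
Proof.
elim=> {l r x} [l r p Pp cp|l r p f x Pp cp Ff cf _ IHx] def_l w w2 Aw rw.
  have centered q : P q -> phi q = 0 ->
      phi ((\prod_(u <- w) u.2) * q * \prod_(u <- w2) u.2) = 0.
    move=> Pq cq; rewrite -mulrA.
    have -> : (\prod_(u <- w) u.2) * (q * \prod_(u <- w2) u.2) =
        \prod_(u <- w ++ (true, q) :: w2) u.2 by rewrite big_cat big_cons.
    by apply: alternates_phi (Aw _ Pq cq) _; case: (w).
  case: cp => [|cp]; last exact: centered.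
  rewrite def_l => /= /rw[w_n0 w20].
  rewrite -[p](subrK (phi p)%:A) mulrDr mulrDl linearD.
  rewrite centered ?phi_centered ?add0r //; last exact: aa_centered.
  rewrite w20 big_nil mulr1 -scalerAr mulr1 linearZ /=.
  rewrite alternates_phi ?mulr0 //.
  exact: alternates_prefix (Aw 0 aa0 (linear0 _)).
have {}cp : phi p = 0 by case: cp; rewrite ?def_l.
have -> : (\prod_(u <- w) u.2) * (p * f * x) * (\prod_(u <- w2) u.2) =
    (\prod_(u <- w ++ [:: (true, p); (false, f)]) u.2) * x * \prod_(u <- w2) u.2.
  by rewrite big_cat /= !big_cons big_nil mulr1 !mulrA.
apply: IHx => // [q Pq cq|/rw[_ ->]]; last by split=> //; case: (w).
by apply: alternates_insert => //; apply: Aw.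
Qed.

(** A [core] with at least one factor from [F]. With arbitrary ends, a bare element of [P] may have
    any value under [phi], whereas one centered factor from [F] forces 0. *)
Definition proper_core l r z : Prop := exists p f x,
  [/\ P p, is_true l \/ phi p = 0, F f, phi f = 0 & core false r x /\ z = p * f * x].

Lemma proper_core_core l r z : proper_core l r z -> core l r z.
Proof. by case=> p [f [x [Pp cp Ff cf [Cx ->]]]]; apply: core_cons. Qed.

Lemma core_cat l r' x : core l r' x -> r' = false -> forall f r y,
  F f -> phi f = 0 -> core false r y -> proper_core l r (x * f * y).
Proof.
elim=> {l r' x} [l r' p Pp cp|l r' p g x Pp cp Fg cg _ IHx] def_r' f r y Ff cf Cy.
  by exists p, f, y; split=> //; rewrite def_r' orbF in cp.
exists p, g, (x * f * y); split=> //; split; last by rewrite !mulrA.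
by apply: proper_core_core; apply: IHx.
Qed.

Lemma core_mulP l r x p : core l r x -> r -> P p -> core l r (x * p).
Proof.
move=> Cx r1 Pp; elim: Cx r1 => {l r x} [l r q Pq cq|l r q f x Pq cq Ff cf _ IHx] r1.
  by apply: core_base; [apply: aa_mul | left; rewrite r1 orbT].
by rewrite -!mulrA mulrA; apply: core_cons => //; apply: IHx.
Qed.

Lemma phi_proper_core l r z : proper_core l r z -> phi z = 0.
Proof.
case=> p [f [x [Pp _ Ff cf [Cx ->]]]].
have Fp q : P q -> phi q = 0 -> phi (q * f * x) = 0.
  move=> Pq cq; have := phi_core_context Cx erefl (w := [:: (true, q);
    (false, f)]) (w2 := [::]).
  rewrite !big_cons !big_nil !mulr1 => -> // q' Pq' cq'.
  split=> // u; rewrite !inE => /or3P[] /eqP-> //.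
have -> : p * f * x = (p - (phi p)%:A) * f * x + phi p *: (f * x).
  by rewrite !mulrBl -!scalerAl mul1r subrK.
rewrite linearD Fp ?phi_centered //; last exact: aa_centered.
rewrite add0r linearZ /=.
have := phi_core_context Cx erefl (w := [:: (false, f)]) (w2 := [::]).
rewrite big_cons !big_nil !mulr1 => -> //; first by rewrite mulr0.
by move=> q' Pq' cq'; split=> // u; rewrite !inE => /orP[] /eqP->.
Qed.

(** The choice [d = star (E x)] turns [phi (x * d)] into the squared norm of [star (E x)]. *)
Lemma E_eq0 x : (forall d, F d -> phi (x * d) = 0) -> E x = 0.
Proof.
move=> x_orth; have FE := vps_codomain vps x.
have Fs : F (star (E x)) by case: (vps_subalgebra vps) => _; apply.
have /(sps_faithful sps) : phi (star (star (E x)) * star (E x)) = 0.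
  by rewrite (starK (sps_star sps)) -(vps_right vps) // -phiE; apply: x_orth.
have star0 : star 0 = 0.
  have := star_antilinear (sps_star sps) (-1) 0 0.
  by rewrite scaler0 addr0 rmorphN1 scaleN1r addNr.
by move/(congr1 star); rewrite (starK (sps_star sps)) star0.
Qed.

(** Splitting [d] into a centered part and a scalar makes freeness applicable to [x * d]. Taking for
    [x] a centered element of [P] shows that [E] is scalar on [P]. *)
Lemma core_expectation x : core false false x -> E x = 0.
Proof.
move=> Cx; apply: E_eq0 => d Fd.
rewrite -[d](subrK (phi d)%:A) mulrDr linearD.
have := phi_core_context Cx erefl (w := [::]) (w2 := [:: (false, d - (phi d)%:A)]).
rewrite big_cons !big_nil mul1r mulr1 => ->; first last.
- by [].
- move=> q Pq cq; split=> // u; rewrite !inE => /orP[] /eqP-> //=.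
  by rewrite phi_centered; split=> //; exact: F_centered.
have := phi_core_context Cx erefl (w := [::]) (w2 := [::]).
rewrite !big_nil mul1r -scalerAr linearZ /= !mulr1 => ->; rewrite ?mulr0 ?addr0 //.
by move=> q Pq cq; split=> // u; rewrite !inE => /eqP->.
Qed.

Local Notation spn := (word_span star a F).
Local Notation Lt b := (if b then star a else 1).
Local Notation Rt c := (if c then 1 else a).

(* With the outer letters split off, only words in aa* and F remain inside. *)
Definition framed b c z : Prop := exists2 x, core b (~~ c) x & z = Lt b * x * Rt c.

Lemma core_span l r x : core l r x -> spn false true x.
Proof.
have Pspan p : P p -> spn false true p.
  apply: generated_algebra_sub.
    apply/unital_subalgebraP; split.
    - by apply: (@word_span_base _ _ _ _ _ false); exact: (vps_1 vps).
    - by move=> c y z Sy Sz; apply: word_span_add => //; apply: (word_spanZ vps).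
    by move=> y z; apply: (word_span_mul vps (c := true) erefl).
  move=> y [->|[c _ <-]].
    exact: (word_span_mul vps (c := false) erefl (word_span_letter a vps false)
              (word_span_letter a vps true)).
  by apply: (@word_span_base _ _ _ _ _ false); exact: (vps_scalar vps).
have Fspan f : F f -> spn false true f by exact: (@word_span_base _ _ _ _ _ false).
elim=> {l r x} [l r p Pp _|l r p f x Pp _ Ff _ _ Sx]; first exact: Pspan.
apply: (word_span_mul vps (c := true) erefl _ Sx).
exact: (word_span_mul vps (c := true) erefl (Pspan p Pp) (Fspan f Ff)).
Qed.

Lemma framed_span b c z : framed b c z -> spn b c z.
Proof.
case=> x /core_span Sx ->.
have La := word_span_letter a vps false; have Ls := word_span_letter a vps true.
have Sl : spn b true (Lt b * x).
  by case: b => /=; [exact: (word_span_mul vps (c := true) erefl Ls Sx) | rewrite mul1r].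
by case: c => /=; [rewrite mulr1 | exact: (word_span_mul vps (c := true) erefl Sl La)].
Qed.

(** As [x] ends with [star a] and [y] begins with [a], the ends facing [f] are centered and
    [core_cat] applies. If the result is framed by [star a] and [a], traciality carries [star a] to
    the far right, where [a * star a] is absorbed by the arbitrary right end. *)
Lemma framed_merge b c x f y : framed b true x -> F f -> phi f = 0 ->
  framed false c y -> framed b c (x * f * y) /\ (b && ~~ c -> phi (x * f * y) = 0).
Proof.
move=> [x1 Cx ->] Ff cf [y1 Cy ->].
have pC := core_cat Cx erefl Ff cf Cy.
have E1 : Lt b * x1 * 1 * f * (1 * y1 * Rt c) = Lt b * (x1 * f * y1) * Rt c.
  by rewrite mulr1 mul1r !mulrA.
rewrite E1; split; first by exists (x1 * f * y1) => //; apply: proper_core_core.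
case/andP=> b1 /negbTE c0; rewrite b1 c0 /= in pC *.
move: (x1 * f * y1) pC => u pC.
rewrite -mulrA (sps_tracial sps) -mulrA; apply: (@phi_proper_core true true).
case: pC => p [g [w [Pp cp Fg cg [Cw ->]]]].
exists p, g, (w * (a * star a)); split=> //; split; last by rewrite !mulrA.
by apply: core_mulP => //; exact: aa_gen.
Qed.

(* The other three types of framed elements have expectation 0 anyway. *)
Definition good b c y : Prop :=
  if b && ~~ c then exists2 z, framed b c z & y = z - (phi z)%:A else framed b c y.

Lemma good_span b c y : good b c y -> spn b c y.
Proof.
rewrite /good; case: ifP => [bc [z fz ->]|_]; last exact: framed_span.
apply: word_span_add; first exact: framed_span.
rewrite -scaleNr; case/andP: bc => -> /negbTE->.
by apply: (@word_span_base _ _ _ _ _ true); exact: (vps_scalar vps).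
Qed.

Lemma good_expectation b c y : ~~ (b && ~~ c) -> good b c y -> E y = 0.
Proof.
move=> nbc; rewrite /good (negbTE nbc); case: b c nbc => [] [] //= _ fy.
- exact: (word_span_odd vps Rdiag (framed_span fy)).
- by case: fy => x Cx ->; rewrite mul1r mulr1; apply: core_expectation.
exact: (word_span_odd vps Rdiag (framed_span fy)).
Qed.

Lemma good_phi b c y : good b c y -> phi y = 0.
Proof.
have [bc|nbc] := boolP (b && ~~ c); last first.
  by move/(good_expectation nbc); rewrite phiE => ->; rewrite linear0.
by rewrite /good bc => -[z _ ->]; exact: phi_centered.
Qed.

Lemma good_merge b c x f y : good b true x -> F f -> phi f = 0 -> good false c y ->
  good b c (x * f * y).
Proof.
rewrite {1 2}/good andbF /= => gx Ff cf gy.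
have [fm phim] := framed_merge gx Ff cf gy.
rewrite /good; case: ifP => [/phim phi0|_] //.
by exists (x * f * y); rewrite // phi0 scale0r subr0.
Qed.

Local Notation cspn := (centered_span star a F E).
Local Notation item := (bool * bool * A)%type.

(** Subtracting [E y] from an item of type [(true, false)] may destroy [good]. This is harmless: a
    processed item that later absorbs an element of [F] on its right ends with [star a], so it has
    another type. *)
Definition prepared (t : item) : Prop :=
  cspn t.1.1 t.1.2 t.2 /\ (good t.1.1 t.1.2 t.2 \/ (t.1.1 && ~~ t.1.2)).

Lemma prepared_expectation (ts : seq item) : (forall t, t \in ts -> prepared t) ->
  sorted (@linked _ A) ts -> ts != [::] -> E (\prod_(t <- ts) t.2) = 0.
Proof.
by move=> Pts; apply: (expectation_linked vps Rdiag) => t /Pts[].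
Qed.

(* A factor y framed by a* and a need only be phi-centered.  Write it as
   (y - E y) + E y: the first summand is E-centered, and E y is a phi-centered
   element of F which merges with the two neighbours of y into one good factor.
   The factors already processed are in pre. *)
Lemma phi_linked_good (ts pre : seq item) :
  sorted (@linked _ A) (pre ++ ts) ->
  (forall t, t \in pre -> prepared t) ->
  (forall t, t \in ts -> good t.1.1 t.1.2 t.2) -> pre ++ ts != [::] ->
  let z := \prod_(t <- pre ++ ts) t.2 in
  let t0 := (true, false, 0) in
  phi z = 0 /\
  (~~ (head t0 (pre ++ ts)).1.1 || (last t0 (pre ++ ts)).1.2 -> E z = 0).
Proof.
(* The outer induction is on the number of factors, the inner one on those not yet processed. *)
move: {2}(size (pre ++ ts)) (leqnn (size (pre ++ ts))) => m.
elim: m ts pre => [|m IHm] ts pre; first by case: pre => //; case: ts.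
elim: ts pre => [|[[b c] y] ts IHts] pre le_m link Ppre Gts n0 z t0.
  suff Ez : E z = 0 by split=> // ; rewrite phiE Ez linear0.
  by rewrite /z cats0; apply: prepared_expectation => //; rewrite cats0 in link n0.
have Gy := Gts _ (mem_head _ _); rewrite /= in Gy.
have Gts' t : t \in ts -> good t.1.1 t.1.2 t.2.
  by move=> ts_t; apply: Gts; rewrite inE ts_t orbT.
have Cy := word_span_centered vps (good_span Gy).
have shift y' : prepared (b, c, y') ->
    let z' := \prod_(t <- pre ++ (b, c, y') :: ts) t.2 in
    phi z' = 0 /\
    (~~ (head t0 (pre ++ (b, c, y) :: ts)).1.1 || (last t0 (pre ++ (b, c, y) :: ts)).1.2
       -> E z' = 0).
  move=> Py'; have := IHts (rcons pre (b, c, y')).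
  rewrite cat_rcons size_cat /= -[X in (X <= _)%N](size_cat pre ((b, c, y) :: ts)).
  move=> /(_ le_m); rewrite -/t0.
  have -> : (head t0 (pre ++ (b, c, y') :: ts)).1.1 =
            (head t0 (pre ++ (b, c, y) :: ts)).1.1 by case: (pre).
  have -> : (last t0 (pre ++ (b, c, y') :: ts)).1.2 =
            (last t0 (pre ++ (b, c, y) :: ts)).1.2.
    by rewrite !last_cat /=; case: (ts).
  apply=> //; last by case: (pre).
    move: link; case: (pre) => [|s pre'] /=; rewrite ?cat_path /=; first by case: (ts).
    by case/and3P=> -> l1 l2; apply/and3P; split=> //; case: (ts) l2.
  by move=> t; rewrite mem_rcons inE => /predU1P[->|/Ppre].
have [bc|nbc] := boolP (b && ~~ c); last first.
  apply: shift; split; last by left.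
  by move: Cy; rewrite (good_expectation nbc Gy) subr0.
case/andP: (bc) => b1 c0; set f := E y in Cy.
have Ff : F f by exact: (vps_codomain vps).
have cf : phi f = 0 by rewrite /f -phiE (good_phi Gy).
have [phi1 E1] := shift (y - f) (conj Cy (or_intror bc)).
have zE : z = \prod_(t <- pre ++ (b, c, y - f) :: ts) t.2 +
    (\prod_(t <- pre) t.2) * f * \prod_(t <- ts) t.2.
  by rewrite /z !big_cat !big_cons /= -(mulrA _ f) -mulrDr -mulrDl subrK.
set z2 := _ * f * _ in zE.
suff [phi2 E2] : phi z2 = 0 /\ (~~ (head t0 (pre ++ (b, c, y) :: ts)).1.1 ||
    (last t0 (pre ++ (b, c, y) :: ts)).1.2 -> E z2 = 0).
  rewrite zE; split=> [|/[dup] /E1 e1 /E2 e2]; first by rewrite linearD phi1 phi2 addr0.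
  by rewrite linearD e1 e2 addr0.
have by_E u : E u = 0 -> phi u = 0 by move=> Eu; rewrite phiE Eu linear0.
rewrite /z2; case/lastP: pre {E1 phi1 zE z2 z shift} le_m link Ppre n0 => [|pre s] le_m
  link Ppre n0.
  case: ts le_m link Gts' {IHts n0 Gts} => [|t ts] le_m link Gts'.
    by rewrite !big_nil mul1r mulr1 /= b1 (negbTE c0).
  (* With no left neighbour, [f] leaves [E] on the left. The rest begins with [a], so the second
     conclusion of the induction hypothesis kills it. *)
  rewrite big_nil mul1r; suff E0 : E (f * \prod_(j <- t :: ts) j.2) = 0.
    by split=> //; apply: by_E.
  rewrite (vps_left vps) //; have link' := path_sorted link.
  have [|_ ->] := IHm (t :: ts) [::] le_m link' _ Gts' isT; rewrite ?mulr0 //.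
  by move: link => /= /andP[/eqP /= <- _]; rewrite c0.
have s_b : s.1.2 = true.
  move: link; rewrite -cats1 -catA /=; case: (pre) => [|u pre'] /=.
    by case/andP=> /eqP->.
  by rewrite cat_path /= => /and4P[_ _ /eqP-> _].
have Gs : good s.1.1 true s.2.
  have [_] : prepared s by apply: Ppre; rewrite mem_rcons mem_head.
  by rewrite s_b andbF; case.
case: ts le_m link Gts' {IHts n0 Gts} => [|t ts] le_m link Gts'.
  (* With no right neighbour, [f] leaves [E] on the right, and only prepared factors remain. *)
  rewrite big_nil mulr1; suff E0 : E (\prod_(j <- rcons pre s) j.2 * f) = 0.
    by split=> //; apply: by_E.
  rewrite (vps_right vps) // prepared_expectation ?mul0r //.
    by move: link => /cat_sorted2[].
  by rewrite -size_eq0 size_rcons.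
have t_b : t.1.1 = false.
  move: link => /cat_sorted2[_ /= /andP[/eqP <- _]]; exact/negbTE.
have Gt : good false t.1.2 t.2 by have := Gts' _ (mem_head _ _); rewrite t_b.
(* Three factors become one. It returns to the unprocessed ones: it is good, but its expectation may
   be nonzero. *)
pose mt : item := (s.1.1, t.1.2, s.2 * f * t.2).
have -> : \prod_(j <- rcons pre s) j.2 * f * \prod_(j <- t :: ts) j.2 =
    \prod_(j <- pre ++ mt :: ts) j.2.
  by rewrite -cats1 !big_cat !big_cons big_nil /= mulr1 !mulrA.
have -> : (head t0 (rcons pre s ++ [:: (b, c, y), t & ts])).1.1 =
          (head t0 (pre ++ mt :: ts)).1.1 by case: (pre).
have -> : (last t0 (rcons pre s ++ [:: (b, c, y), t & ts])).1.2 =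
          (last t0 (pre ++ mt :: ts)).1.2 by rewrite !last_cat /=; case: (ts).
apply: IHm.
- by move: le_m; rewrite !size_cat size_rcons /=; lia.
- move: link; rewrite cat_rcons; case: (pre) => [|u pre'] /=.
    by case/and3P=> _ _; case: (ts).
  rewrite !cat_path /= => /and5P[-> us _ _ tts]; apply/and3P; split=> //.
  by case: (ts) tts.
- by move=> u u_pre; apply: Ppre; rewrite mem_rcons inE u_pre orbT.
- move=> u; rewrite inE => /predU1P[->|u_ts]; first exact: good_merge.
  by apply: Gts'; rewrite inE u_ts orbT.
by case: (pre).
Qed.

Lemma typed_letters e : typed (letters star a F) e [seq star_pow star a b | b <- e].
Proof.
elim: e => //= b e IHe; split=> //; exists 1, 1; rewrite mulr1 mul1r.
by split=> //; exact: (vps_1 vps).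
Qed.

Lemma phi_odd_word e : sorted neqb e -> odd (size e) -> phi (word star a e) = 0.
Proof.
move=> _ odd_e; rewrite phiE /word -(big_map _ predT id).
by rewrite (expectation_odd vps Rdiag (typed_letters e)) ?size_map ?linear0.
Qed.

Lemma word_framed b e : path neqb b e -> exists2 x, P x &
  word star a (b :: e) = Lt b * x * Rt (last b e).
Proof.
elim: e b => [|c e IHe] b.
  move=> _; exists 1; first exact: aa1.
  by rewrite /word big_seq1 mulr1 /=; case: b; rewrite ?mulr1 ?mul1r.
case/andP=> bc /IHe[x Px wE]; rewrite /word big_cons -/(word _ _ _) wE /=.
case: b c bc {IHe wE} => [] [] //= _.
  by exists x => //; rewrite mul1r mulrA.
exists (a * star a * x); first by apply: aa_mul => //; exact: aa_gen.
by rewrite mul1r !mulrA.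
Qed.

Lemma word_good b e : path neqb b e ->
  good b (last b e) (word star a (b :: e) - (phi (word star a (b :: e)))%:A).
Proof.
move=> p_e; have [x Px wE] := word_framed p_e; rewrite /good.
set w := word _ _ _ in wE *.
case: ifP => [bc|nbc].
  exists w => //; exists x => //; apply: core_base => //; left.
  by case/andP: bc => ->.
have lE := @last_sorted b e p_e.
have [odd_e|even_e] := boolP (odd (size e)); last first.
  (* The whole word has odd length, so centering changes nothing, and its frame leaves one end
     arbitrary. *)
  rewrite phi_odd_word //=; rewrite scale0r subr0.
  exists x => //; apply: core_base => //; left.
  by rewrite lE (negbTE even_e) addbF orbN.
(* Type [(false, true)]: the frame is trivial, so centering the word means centering an element of
   [P]. *)
move: nbc wE; rewrite lE odd_e addbT; case: (b) => //= _ ->.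
exists (x - (phi x)%:A); first by apply: core_base; [exact: aa_centered|right;
  exact: phi_centered].
by rewrite !mul1r !mulr1.
Qed.

Lemma scalar_words_R_diagonal : scalar_R_diagonal phi star a.
Proof.
apply: scalar_R_diagonal_moments; [exact: sps_unit sps|exact: phi_odd_word|].
move=> es es_n0 ch.
pose it e : item := (head true e, last true e, word star a e - (phi (word star a e))%:A).
have := @phi_linked_good [seq it e | e <- es] [::].
rewrite /= big_map => H; apply: (proj1 (H _ _ _ _)) => //.
- have link e es' : chained (Some (last true e)) es' ->
      path (@linked _ A) (it e) [seq it e' | e' <- es'].
    elim: es' e => [//|[//|b f] es' IHes] e /= /and3P[_ eq_b ch'].
    by rewrite {1}/linked /= eq_sym eq_b /= IHes.
  case: es ch {es_n0 H} => [//|[//|b f] es] /and3P[_ _ ch]; exact: (link (b :: f)).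
- move=> t /mapP[e es_e ->] /=; have := chained_sorted ch es_e.
  by case: e {es_e} (allP (chained_neq0 ch) _ es_e) => // b f _; apply: word_good.
by rewrite -size_eq0 size_map size_eq0.
Qed.

End ScalarWords.

Theorem theorem14 (R : realType) (A : algType R[i]) (star : A -> A)
    (F : set A) (E : {linear A -> A}) (phi : {scalar A}) (a : A) :
  valued_probability_space star F E ->
  scalar_probability_space star phi ->
  (forall x, phi x = phi (E x)) ->
  R_diagonal F E star a ->
  free_pair phi [set a * star a] F ->
  scalar_R_diagonal phi star a.
Proof. exact: scalar_words_R_diagonal. Qed.
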